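(* Let $n,m\in\mathbb{N}$. The Schützenberger groups of $M_{n\times m}(\mathbb{FT})$ are, up to isomorphism, exactly the groups of the form $G\times\mathbb{R}$ where $G\le\mathcal{S}_n$ is a finite group with a paired 2-closed permutation representation on $n$ and $m$ points.
   Context: $\mathbb{N}$ is the set of positive integers. $\mathbb{FT}=\mathbb{R}$ is the finitary tropical semiring, with $\oplus=\max$ and $\otimes=+$ (i.e. the tropical semiring $\mathbb{R}\cup\{-\infty\}$ without $-\infty$). $M(\mathbb{FT})$ is the semigroupoid (category without the requirement that identities exist) of all matrices of any (positive) size over $\mathbb{FT}$, with tropical matrix multiplication whenever sizes are compatible; $M_{n\times m}(\mathbb{FT})$ is the set of $n\times m$ matrices. Let $S=M(\mathbb{FT})$ and let $S^1$ be the category obtained by adjoining an identity arrow to each object (size) lacking one. For $a,b\in S$: $a\mathrel{\mathcal{R}}b$ if $aS^1=bS^1$, $a\mathrel{\mathcal{L}}b$ if $S^1a=S^1b$ (all products that are defined), and $a\mathrel{\mathcal{H}}b$ if both hold. For an $\mathcal{H}$-class $H$ and $s\in S^1$ such that $sh$ is defined for all $h\in H$ and $sH\subseteq H$, let $\phi_s\colon H\to H$, $a\mapsto sa$. The (left) Schützenberger group of $H$ is $\Gamma_H=\{\phi_s : s\in S^1,\ sH\subseteq H\}$, a group under composition; the right Schützenberger group, defined dually, is isomorphic to it. The Schützenberger groups of $M_{n\times m}(\mathbb{FT})$ are the groups $\Gamma_H$ where $H$ is an $\mathcal{H}$-class of $M(\mathbb{FT})$ contained in $M_{n\times m}(\mathbb{FT})$.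 In $G\times\mathbb{R}$, $\mathbb{R}$ denotes the additive group of real numbers; $\mathcal{S}_n$ is the symmetric group on $\{1,\dots,n\}$. Paired 2-closed: let $G$ be a finite group with faithful actions on finite sets $\Omega$ and $\Gamma$, regarded as a subgroup of $\mathcal{S}_\Omega\times\mathcal{S}_\Gamma$ via the diagonal action of these two actions. $G$ is paired 2-closed on $\Omega$ and $\Gamma$ if $G$ contains every element of $\mathcal{S}_\Omega\times\mathcal{S}_\Gamma$ which preserves each $G$-orbit of pairs in $\Omega\times\Gamma$. $G$ has a paired 2-closed permutation representation on $n$ and $m$ points if this holds for some such faithful actions with $|\Omega|=n$ and $|\Gamma|=m$. *)

(* Defs.v *)
From mathcomp Require Import all_boot all_order all_algebra all_fingroup.
From mathcomp Require Import boolp classical_sets reals.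

Set Implicit Arguments.
Unset Strict Implicit.
Unset Printing Implicit Defensive.

Import Order.TTheory GRing.Theory Num.Theory.

(* [comp a b] is the product ab: the codomain of a is the domain of b. *)
Record semigroupoid := Semigroupoid {
  obj : Type;
  hom : obj -> obj -> Type;
  comp : forall x y z, hom x y -> hom y z -> hom x z;
  compA : forall x y z w (a : hom x y) (b : hom y z) (c : hom z w),
    comp a (comp b c) = comp (comp a b) c
}.
Arguments comp {s x y z} a b.

Section Green.
Variable S : semigroupoid.
Implicit Types x y z : obj S.

Record arrow := Arrow { dom : obj S; cod : obj S; arr : hom dom cod }.

Definition has_identity x : Prop :=
  exists e : hom x x,
    (forall y (a : hom x y), comp e a = a) /\
    (forall y (a : hom y x), comp a e = a).

(* The arrows of S^1, where identities are adjoined only to the objects lacking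
   one. *)
Inductive hom1 x : obj S -> Type :=
| OldArrow y of hom x y : hom1 x y
| NewIdentity of ~ has_identity x : hom1 x x.

Definition lmul1 x y (s : hom1 x y) : forall z, hom y z -> hom x z :=
  match s in hom1 _ y0 return forall z, hom y0 z -> hom x z with
  | OldArrow _ a => fun z b => comp a b
  | NewIdentity _ => fun z b => b
  end.

Definition rmul1 x y (s : hom1 x y) : forall w, hom w x -> hom w y :=
  match s in hom1 _ y0 return forall w, hom w x -> hom w y0 with
  | OldArrow _ a => fun w b => comp b a
  | NewIdentity _ => fun w b => b
  end.

(* a S^1 *)
Definition right_ideal (a : arrow) : set arrow :=
  fun c => exists z (s : hom1 (cod a) z), c = Arrow (rmul1 s (arr a)).

(* S^1 a *)
Definition left_ideal (a : arrow) : set arrow :=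
  fun c => exists x (s : hom1 x (dom a)), c = Arrow (lmul1 s (arr a)).

Definition greenR (a b : arrow) : Prop := right_ideal a = right_ideal b.
Definition greenL (a b : arrow) : Prop := left_ideal a = left_ideal b.
Definition greenH (a b : arrow) : Prop := greenR a b /\ greenL a b.

Definition is_Hclass (H : set arrow) : Prop := exists a, H = greenH a.

(* The product s h is defined and equal to k. *)
Definition lmul_to x y (s : hom1 x y) (h k : arrow) : Prop :=
  exists z (b : hom y z), h = Arrow b /\ k = Arrow (lmul1 s b).

(* The maps phi_s; that phi maps H to H encodes the condition s H `<=` H. *)
Definition schutzenberger_group (H : set arrow) : set (H -> H) :=
  fun phi => exists x y (s : hom1 x y),
    forall h : H, lmul_to s (val h) (val (phi h)).

End Green.
Arguments Arrow {S dom cod} arr.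

Section Tropical.
Variable R : realType.
Local Open Scope ring_scope.

(* The initial value of the maximum is one of its terms, hence harmless. *)
Definition trop_mul (n p m : nat)
    (A : 'M[R]_(n.+1, p.+1)) (B : 'M[R]_(p.+1, m.+1)) : 'M[R]_(n.+1, m.+1) :=
  \matrix_(i, j) \big[Num.max/A i ord0 + B ord0 j]_(k < p.+1) (A i k + B k j).

Lemma trop_mul_le n p m (A : 'M[R]_(n.+1, p.+1)) (B : 'M[R]_(p.+1, m.+1)) i j c :
  trop_mul A B i j <= c <-> forall k, A i k + B k j <= c.
Proof.
rewrite mxE; split => [/bigmax_leP[_ le_c] k|le_c]; first exact: le_c.
by apply/bigmax_leP; split => [|k _]; exact: le_c.
Qed.

Lemma trop_mulA n p q m (A : 'M[R]_(n.+1, p.+1)) (B : 'M[R]_(p.+1, q.+1))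
    (C : 'M[R]_(q.+1, m.+1)) :
  trop_mul A (trop_mul B C) = trop_mul (trop_mul A B) C.
Proof.
apply/matrixP => i j; apply/le_anti/andP; split.
- apply/trop_mul_le => k; rewrite -lerBrDl; apply/trop_mul_le => l.
  rewrite lerBrDl addrA.
  have /trop_mul_le/(_ l) := lexx (trop_mul (trop_mul A B) C i j).
  by apply: le_trans; rewrite lerD2r; apply/trop_mul_le: k.
- apply/trop_mul_le => l; rewrite -lerBrDr; apply/trop_mul_le => k.
  rewrite lerBrDr -addrA.
  have /trop_mul_le/(_ k) := lexx (trop_mul A (trop_mul B C) i j).
  by apply: le_trans; rewrite lerD2l; apply/trop_mul_le: l.
Qed.

(* Sizes are positive, so the object n : nat stands for the size n.+1. *)
Definition MFT : semigroupoid :=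
  @Semigroupoid nat (fun n m => 'M[R]_(n.+1, m.+1)) trop_mul trop_mulA.

(* M_{n.+1 x m.+1}(FT), as a set of arrows *)
Definition MFT_size (n m : nat) : set (arrow MFT) :=
  range (fun A : 'M[R]_(n.+1, m.+1) => @Arrow MFT n m A).

(* The law on G x R is that of the direct product with the additive group R. An
   injective morphism with range Gamma_H in particular transports the group
   structure to Gamma_H, so this is isomorphism of groups. *)
Definition schutzenberger_iso_prod (H : set (arrow MFT))
    (gT : finGroupType) (G : {group gT}) : Prop :=
  exists f : subg_of G * R -> (H -> H),
    [/\ injective f,
        range f = schutzenberger_group (H := H)
      & forall u v, f ((u.1 * v.1)%g, u.2 + v.2) = f u \o f v].

End Tropical.
Arguments MFT_size R n m : clear implicits.

Section PairAction.
Variables Omega Gamma : finType.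

Definition pair_act (p : Omega * Gamma) (u : {perm Omega} * {perm Gamma}) :=
  (u.1 p.1, u.2 p.2).

Lemma pair_act1 : pair_act^~ 1%g =1 id.
Proof. by case=> x y; rewrite /pair_act /= !perm1. Qed.

Lemma pair_actM p : act_morph pair_act p.
Proof. by move=> u v; rewrite /pair_act /= !permM. Qed.

Definition pair_action := TotalAction pair_act1 pair_actM.

End PairAction.

Section Paired2Closed.
Variables (gT : finGroupType) (G : {group gT}) (Omega Gamma : finType).
Variables (toO : action G Omega) (toG : action G Gamma).

(* G as a subgroup of Sym(Omega) x Sym(Gamma) *)
Definition diagonal_image : {set {perm Omega} * {perm Gamma}} :=
  [set (actperm toO g, actperm toG g) | g in G].

Definition preserves_pair_orbits (u : {perm Omega} * {perm Gamma}) : Prop :=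
  forall p : Omega * Gamma,
    let O := orbit (pair_action Omega Gamma) diagonal_image p in
    [set pair_act q u | q in O] = O.

Definition paired_2closed : Prop :=
  forall u, preserves_pair_orbits u -> u \in diagonal_image.

End Paired2Closed.

Definition has_paired_2closed_rep (gT : finGroupType) (G : {group gT})
    (n m : nat) : Prop :=
  exists (Omega Gamma : finType) (toO : action G Omega) (toG : action G Gamma),
    [/\ #|Omega| = n, #|Gamma| = m,
        [faithful G, on [set: Omega] | toO],
        [faithful G, on [set: Gamma] | toG]
      & paired_2closed toO toG].

(* Main.v *)
Require Import Defs.
From mathcomp Require Import all_boot all_order all_algebra all_fingroup.
From mathcomp Require Import boolp classical_sets reals.
From mathcomp Require Import lra ring.

(** Multiplication on either side by a finitary tropical matrix takes combinations
   of rows or of columns, so an H-class consists of the matrices with a given row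
   space and a given column space. Keeping a minimal generating set of rows and one
   of columns cuts a matrix down to a core in which no row and no column is a
   combination of the others ([exists_core]). The members of the H-class correspond
   to the matrices with the same row and column spaces as the core, and
   irredundancy forces these to be at once row rearrangements and column
   rearrangements of the core, up to adding constants to rows and columns
   ([irr_rows_monomial]). The constants are removed by double centring: the pairs of
   permutations that occur are exactly the automorphisms of the centred core, and
   each of them determines the constants up to one common real number. Normalising
   by row means splits off this real number, whence the Schutzenberger group is the
   product of the automorphism group of the centred core by the reals
   ([schutzenberger_core]).

   The automorphism group of a matrix is paired 2-closed, because a pair of
   permutations that preserves its orbits preserves the entries; fixed points can be
   added on either side without harm ([irr_realizes]). This settles one direction.

   Conversely, a paired 2-closed representation of [G] must be turned into an
   irredundant matrix whose centred form has automorphism group [G]. This can fail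
   for the representation at hand: a set of two rows cannot bear more than two
   irredundant columns, however many columns are fixed by [G] or repeat an orbit
   already present. Such superfluous points are deleted first
   ([paired_rep_drop_fixed], [paired_rep_drop_dup]); this shrinks the matrix, but the
   lost rows and columns can be restored as copies of others
   ([realizable_schutzenberger]). Up to exchanging rows and columns there are then at
   most as many row orbits as column orbits, and one orbit of pairs can be chosen in
   every column orbit so that every row is met. Very large entries on the chosen
   orbits, with heights and small corrections that keep columns with nested or equal
   sets of large entries apart, make all rows and columns irredundant
   ([construction_irr_rows], [construction_irr_cols]). Finally a small invariant
   perturbation puts the entries in general position ([separating_perturbation]), so
   that an automorphism of the centred matrix preserves the orbits of [G] on pairs
   and hence belongs to [G] ([construction_realizes]). *)

Set Implicit Arguments.
Unset Strict Implicit.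
Unset Printing Implicit Defensive.

Import Order.TTheory GRing.Theory Num.Theory.
Local Open Scope ring_scope.

(** * Factorisation of tropical matrices *)

Section TropicalFactorisation.
Variable R : realType.

Lemma trop_mul_ge n p m (A : 'M[R]_(n.+1, p.+1)) (B : 'M[R]_(p.+1, m.+1)) i j k :
  A i k + B k j <= trop_mul A B i j.
Proof. by have /trop_mul_le/(_ k) := lexx (trop_mul A B i j). Qed.

Lemma trop_mul_attained n p m
    (A : 'M[R]_(n.+1, p.+1)) (B : 'M[R]_(p.+1, m.+1)) i j :
  exists k, trop_mul A B i j = A i k + B k j.
Proof.
apply: contrapT => no_k.
suff: trop_mul A B i j < trop_mul A B i j by rewrite ltxx.
have lt_k k : A i k + B k j < trop_mul A B i j.
  by rewrite lt_neqAle trop_mul_ge andbT; apply/eqP => eq_k; apply: no_k; exists k.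
by rewrite {1}mxE; apply/bigmax_ltP; split.
Qed.

Lemma trop_mul_eq n p m (A : 'M[R]_(n.+1, p.+1)) (B : 'M[R]_(p.+1, m.+1))
    (C : 'M[R]_(n.+1, m.+1)) :
  (forall i j k, A i k + B k j <= C i j) ->
  (forall i j, exists k, C i j = A i k + B k j) -> trop_mul A B = C.
Proof.
move=> le_C att; apply/matrixP => i j; apply/le_anti/andP; split.
  by apply/trop_mul_le => k; exact: le_C.
by have [k ->] := att i j; exact: trop_mul_ge.
Qed.

Lemma tr_trop_mul n p m (A : 'M[R]_(n.+1, p.+1)) (B : 'M[R]_(p.+1, m.+1)) :
  (trop_mul A B)^T = trop_mul B^T A^T.
Proof.
apply/esym/trop_mul_eq => [i j k|i j]; rewrite [trop_mul]lock !mxE -lock.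
  by rewrite addrC; exact: trop_mul_ge.
by have [k ->] := trop_mul_attained A B j i; exists k; rewrite !mxE addrC.
Qed.

(** Row [k] of [B], raised as far as it stays below row [i] of [A], meets it in
   column [j]. *)
Definition supports n p m (A : 'M[R]_(n, m)) (B : 'M[R]_(p, m)) i k j :=
  forall j', A i j + B k j' <= A i j' + B k j.

Lemma supports_refl n m (A : 'M[R]_(n, m)) i j : supports A A i i j.
Proof. by move=> j'; rewrite addrC. Qed.

Lemma supports_trans n p q m (A : 'M[R]_(n, m)) (B : 'M[R]_(p, m))
    (C : 'M[R]_(q, m)) i k l j :
  supports A B i k j -> supports B C k l j -> supports A C i l j.
Proof. by move=> AB BC j'; have := AB j'; have := BC j'; lra. Qed.

(** The coefficient at [(i, k)] is the largest amount by which row [k] of [B] can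
   be raised while staying below row [i] of [C]; residuation shows that this
   choice is optimal. *)
Lemma trop_factor n p m (C : 'M[R]_(n.+1, m.+1)) (B : 'M[R]_(p.+1, m.+1)) :
  (forall i j, exists k, supports C B i k j) -> exists X, trop_mul X B = C.
Proof.
move=> sup.
pose X := \matrix_(i, k)
  (- \big[Num.max/B k ord0 - C i ord0]_(j < m.+1) (B k j - C i j)).
have X_le i j k : X i k + B k j <= C i j.
  rewrite mxE addrC lerBlDr -lerBlDl.
  exact: (le_bigmax _ (fun j => B k j - C i j)).
exists X; apply: trop_mul_eq => // i j.
have [k sup_k] := sup i j; exists k; apply/le_anti; rewrite X_le andbT.

rewrite mxE addrC lerBrDr -lerBrDl.
by apply/bigmax_leP; split=> [|j' _]; have := sup_k; [move/(_ ord0)|move/(_ j')]; lra.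
Qed.

Lemma trop_factorr n p m (C : 'M[R]_(n.+1, m.+1)) (B : 'M[R]_(n.+1, p.+1)) :
  (forall i j, exists k, supports C^T B^T j k i) -> exists X, trop_mul B X = C.
Proof.
move=> sup; have [j i|X eqC] := @trop_factor m p n C^T B^T; first exact: sup.
by exists X^T; apply: trmx_inj; rewrite tr_trop_mul trmxK.
Qed.

Lemma trop_unitl n m (A : 'M[R]_(n.+1, m.+1)) : exists E, trop_mul E A = A.
Proof. by apply: trop_factor => i j; exists i; exact: supports_refl. Qed.

Lemma trop_unitr n m (A : 'M[R]_(n.+1, m.+1)) : exists E, trop_mul A E = A.
Proof. by apply: trop_factorr => i j; exists j; exact: supports_refl. Qed.

End TropicalFactorisation.

(** * H-classes of tropical matrices *)

Section HClasses.
Variable R : realType.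

(** A matrix read off an arrow whose sizes are known only propositionally. *)
Definition arrow_mx n m (a : arrow (MFT R)) : 'M[R]_(n.+1, m.+1) :=
  match @eqP nat (Defs.dom a) n, @eqP nat (Defs.cod a) m with
  | ReflectT eq_n, ReflectT eq_m =>
    castmx (congr1 S eq_n, congr1 S eq_m) (arr a : 'M[R]_((Defs.dom a).+1, (Defs.cod a).+1))
  | _, _ => 0
  end.

Definition mx_arrow n m (A : 'M[R]_(n.+1, m.+1)) : arrow (MFT R) :=
  @Arrow (MFT R) n m A.

Lemma mx_arrowK n m : cancel (@mx_arrow n m) (@arrow_mx n m).
Proof.
move=> A; rewrite /arrow_mx /=.
by case: eqP => // eq_n; case: eqP => // eq_m; rewrite castmx_id.
Qed.

Lemma mx_arrow_inj n m : injective (@mx_arrow n m).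
Proof. exact: can_inj (@mx_arrowK n m). Qed.

(** Every matrix has local units, so adjoining identities adds no divisors: the
   ideals of [S^1] and those of [S] give the same Green relations. *)
Lemma right_idealP n m (A : 'M[R]_(n.+1, m.+1)) c :
  right_ideal (mx_arrow A) c <-> exists q X, c = @mx_arrow n q (trop_mul A X).
Proof.
split=> [[q [s ->]]|[q [X ->]]]; last by exists q, (@OldArrow (MFT R) m q X).
case: _ / s => [q' X|_] /=; first by exists q', X.
by have [E eqA] := trop_unitr A; exists m, E; rewrite eqA.
Qed.

Lemma left_idealP n m (A : 'M[R]_(n.+1, m.+1)) c :
  left_ideal (mx_arrow A) c <-> exists q X, c = @mx_arrow q m (trop_mul X A).
Proof.
split=> [[q [s ->]]|[q [X ->]]]; last by exists q, (@OldArrow (MFT R) q n X).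
change (@hom1 (MFT R) q n) in s; rewrite /= in s *.
move: A; case: _ / s => [n' X|_] /= A; first by exists q, X.
by have [E eqA] := trop_unitl A; exists q, E; rewrite eqA.
Qed.

Lemma greenHP n m (A : 'M[R]_(n.+1, m.+1)) (b : arrow (MFT R)) :
  greenH (mx_arrow A) b <->
  exists2 B, b = mx_arrow B &
    ((exists X, B = trop_mul A X) /\ (exists X, A = trop_mul B X)) /\
    ((exists X, B = trop_mul X A) /\ (exists X, A = trop_mul X B)).
Proof.
split=> [[eqR eqL]|[B ->]].
  have self_r k l (C : 'M[R]_(k.+1, l.+1)) : right_ideal (mx_arrow C) (mx_arrow C).
    by apply/right_idealP; have [E eqC] := trop_unitr C; exists l, E; rewrite eqC.
  have self_l k l (C : 'M[R]_(k.+1, l.+1)) : left_ideal (mx_arrow C) (mx_arrow C).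
    by apply/left_idealP; have [E eqC] := trop_unitl C; exists k, E; rewrite eqC.
  case: b eqR eqL => k l B eqR eqL.
  have : right_ideal (mx_arrow A) (mx_arrow B) by rewrite eqR.
  case/right_idealP => q [X] eqB; have eq_k : k = n by case: eqB.
  have : left_ideal (mx_arrow A) (mx_arrow B) by rewrite eqL.
  case/left_idealP => q' [Y] eqB'; have eq_l : l = m by case: eqB'.
  subst k l.
  exists B => //.
  have [Ar Al] : right_ideal (mx_arrow B) (mx_arrow A) /\ left_ideal (mx_arrow B) (mx_arrow A).
    by rewrite -eqR -eqL; split; [exact: self_r | exact: self_l].
  have [Br Bl] : right_ideal (mx_arrow A) (mx_arrow B) /\ left_ideal (mx_arrow A) (mx_arrow B).
    by rewrite eqR eqL; split; [exact: self_r | exact: self_l].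
  split; split.
  - case/right_idealP: Br => r [Z] e; have eq_r : r = m by case: e.
    by move: Z e; rewrite eq_r => Z /mx_arrow_inj ->; exists Z.
  - case/right_idealP: Ar => r [Z] e; have eq_r : r = m by case: e.
    by move: Z e; rewrite eq_r => Z /mx_arrow_inj ->; exists Z.
  - case/left_idealP: Bl => r [Z] e; have eq_r : r = n by case: e.
    by move: Z e; rewrite eq_r => Z /mx_arrow_inj ->; exists Z.
  - case/left_idealP: Al => r [Z] e; have eq_r : r = n by case: e.
    by move: Z e; rewrite eq_r => Z /mx_arrow_inj ->; exists Z.
case=> [[[X eqB] [Y eqA]] [[Z eqB'] [W eqA']]]; split; apply/seteqP; split=> c.
- case/right_idealP => q [U ->]; apply/right_idealP; exists q, (trop_mul Y U).
  by rewrite trop_mulA -eqA.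
- case/right_idealP => q [U ->]; apply/right_idealP; exists q, (trop_mul X U).
  by rewrite trop_mulA -eqB.
- case/left_idealP => q [U ->]; apply/left_idealP; exists q, (trop_mul U W).
  by rewrite -trop_mulA -eqA'.
- case/left_idealP => q [U ->]; apply/left_idealP; exists q, (trop_mul U Z).
  by rewrite -trop_mulA -eqB'.
Qed.

End HClasses.

(** * Centred matrices and irredundant rows *)

Section Centering.
Variable R : realType.

(** The doubly centred matrix, up to the factor [n * m]: a sum of 2x2 alternating
   sums, hence insensitive to adding constants to rows and to columns. *)
Definition center n m (A : 'M[R]_(n, m)) : 'M[R]_(n, m) :=
  \matrix_(x, y) \sum_x' \sum_y' (A x y + A x' y' - A x y' - A x' y).

Lemma center_tr n m (A : 'M[R]_(n, m)) : center A^T = (center A)^T.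
Proof.
apply/matrixP => y x; rewrite !mxE exchange_big /=.
by apply: eq_bigr => x' _; apply: eq_bigr => y' _; rewrite !mxE addrAC.
Qed.

Lemma center_shift n m (A B : 'M[R]_(n, m)) (s : 'S_n) (t : 'S_m) l d :
  (forall x y, B x y = A (s x) (t y) + l x + d y) ->
  forall x y, center B x y = center A (s x) (t y).
Proof.
move=> eqB x y; rewrite !mxE [RHS](reindex_inj (@perm_inj _ s)) /=.
apply: eq_bigr => x' _; rewrite [RHS](reindex_inj (@perm_inj _ t)) /=.
by apply: eq_bigr => y' _; rewrite !eqB; ring.
Qed.

Definition row_mean n m (A : 'M[R]_(n, m)) x : R := (\sum_y A x y) / m%:R.

Definition col_rest n m (A : 'M[R]_(n, m)) y : R :=
  (\sum_x A x y) / n%:R - (\sum_x \sum_y' A x y') / (n * m)%:R.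

Lemma centerE n m (A : 'M[R]_(n, m)) x y :
  center A x y = (n * m)%:R * A x y + \sum_x' \sum_y' A x' y'
     - n%:R * \sum_y' A x y' - m%:R * \sum_x' A x' y.
Proof.
rewrite mxE.
under eq_bigr do rewrite !sumrB big_split /= !sumr_const card_ord.
rewrite !sumrB big_split /= !sumr_const !card_ord.
by rewrite natrM -mulrA !mulr_natl sumrMnl.
Qed.

Lemma center_decomp n m (A : 'M[R]_(n.+1, m.+1)) x y :
  A x y = center A x y / (n.+1 * m.+1)%:R + row_mean A x + col_rest A y.
Proof.
rewrite centerE /row_mean /col_rest natrM.
have n0 : n.+1%:R != 0 :> R by rewrite pnatr_eq0.
have m0 : m.+1%:R != 0 :> R by rewrite pnatr_eq0.
move: (n.+1%:R : R) (m.+1%:R : R) n0 m0 => a b a0 b0.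
by field; rewrite a0 b0.
Qed.

(** Row [x] is not a combination of the other rows: in some column [y] none of
   them reaches it. *)
Definition irr_rows n m (A : 'M[R]_(n, m)) :=
  forall x, exists y, forall x', x' != x -> ~ supports A A x x' y.

Lemma irr_rows_inj n m (A : 'M[R]_(n, m)) x x' c :
  irr_rows A -> (forall y, A x y = A x' y + c) -> x = x'.
Proof.
move=> irrA eqA; have [y irr_y] := irrA x; apply/eqP/negPn/negP => ne.
by apply: (irr_y x'); [rewrite eq_sym | move=> y'; rewrite !eqA; lra].
Qed.

(** In a column where only row [x] reaches itself, the chain of maxima computing
   [S'(SA)] must come back to [x], so that some entries of [S'] and [S] cancel;
   this pins the corresponding row of [SA] between two equal bounds. *)
Lemma irr_rows_monomial n m (A : 'M[R]_(n.+1, m.+1)) S S' :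
  irr_rows A -> trop_mul S' (trop_mul S A) = A ->
  exists (s : 'S_n.+1) l, forall x y, trop_mul S A x y = A (s x) y + l x.
Proof.
move=> irrA eqA.
have S'_le x z y : S' x z + trop_mul S A z y <= A x y.
  by rewrite -{2}eqA; exact: trop_mul_ge.
have cancel_at x : exists z, S' x z + S z x = 0.
  have [y irr_y] := irrA x.
  have [z eqz] := trop_mul_attained S' (trop_mul S A) x y.
  have [w eqw] := trop_mul_attained S A z y.
  rewrite eqA eqw in eqz; exists z.
  have [ew|ne] := eqVneq w x; first by move: eqz; rewrite ew; lra.
  case: (irr_y w ne) => y'.
  by have := S'_le x z y'; have := trop_mul_ge S A z y' w; lra.
have [f fP] := choice cancel_at.
have eqf x y : trop_mul S A (f x) y = A x y + S (f x) x.
  apply/le_anti/andP; split.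
    by have := S'_le x (f x) y; have := fP x; lra.
  by rewrite addrC; exact: trop_mul_ge.
have f_inj : injective f.
  move=> x x' eq_f; apply: (@irr_rows_inj _ _ A x x' (S (f x') x' - S (f x) x)) => // y.
  by have := eqf x y; have := eqf x' y; rewrite eq_f; lra.
exists (perm f_inj)^-1%g, (fun z => S z ((perm f_inj)^-1%g z)) => z y.
have /= := eqf ((perm f_inj)^-1%g z) y.
by rewrite -(permE f_inj) permKV.
Qed.

End Centering.

(** * The Schutzenberger group of a matrix with a core *)

Section Core.
Variable R : realType.

(** Every row of [A] is a combination of rows of [B]. *)
Definition generates n p m (A : 'M[R]_(n, m)) (B : 'M[R]_(p, m)) :=
  forall i j, exists k, supports A B i k j.

Lemma rowsub_trop_mul n n' p m (f : 'I_n'.+1 -> 'I_n.+1)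
    (A : 'M[R]_(n.+1, p.+1)) (B : 'M[R]_(p.+1, m.+1)) :
  rowsub f (trop_mul A B) = trop_mul (rowsub f A) B.
Proof. by apply/matrixP => i j; rewrite !mxE; apply: eq_bigr => k _; rewrite mxE. Qed.

Lemma colsub_trop_mul n p m m' (f : 'I_m'.+1 -> 'I_m.+1)
    (A : 'M[R]_(n.+1, p.+1)) (B : 'M[R]_(p.+1, m.+1)) :
  colsub f (trop_mul A B) = trop_mul A (colsub f B).
Proof. by apply/matrixP => i j; rewrite !mxE; apply: eq_bigr => k _; rewrite mxE. Qed.

(** Automorphisms are taken of the centred matrix, where rearrangements up to
   additive constants become plain rearrangements. *)
Definition realizes (gT : finGroupType) (G : {group gT}) p q
    (A : 'M[R]_(p, q)) (rho : gT -> 'S_p * 'S_q) :=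
  [/\ irr_rows A, irr_rows A^T,
      {in G &, {morph rho : g h / (g * h)%g}},
      {in G &, injective rho}
    & forall u : 'S_p * 'S_q,
        (forall x y, center A (u.1 x) (u.2 y) = center A x y) <->
        (exists2 g, g \in G & u = rho g)].

Lemma irr_rows_aut_inj p q (A : 'M[R]_(p.+1, q.+1)) (s s' : 'S_p.+1) (t : 'S_q.+1) :
  irr_rows A ->
  (forall x y, center A (s x) (t y) = center A x y) ->
  (forall x y, center A (s' x) (t y) = center A x y) -> s = s'.
Proof.
move=> irrA es es'; apply/permP => x.
apply: (@irr_rows_inj _ _ _ A _ _ (row_mean A (s x) - row_mean A (s' x))) => // y.
rewrite [A (s x) y]center_decomp [A (s' x) y]center_decomp.
rewrite -[y](permKV t) es es'; move: (_ / _) => z; lra.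
Qed.

Lemma irr_cols_aut_inj p q (A : 'M[R]_(p.+1, q.+1)) (s : 'S_p.+1) (t t' : 'S_q.+1) :
  irr_rows A^T ->
  (forall x y, center A (s x) (t y) = center A x y) ->
  (forall x y, center A (s x) (t' y) = center A x y) -> t = t'.
Proof.
by move=> irrA et et'; apply: (irr_rows_aut_inj (t := s) irrA) => y x;
  rewrite center_tr [LHS]mxE [RHS]mxE.
Qed.

(** The row operation, by a permutation and scalars, that agrees on [A] with a
   column operation when [s] is part of an automorphism of [center A]. *)
Definition twist p q (A : 'M[R]_(p.+1, q.+1)) (s : 'S_p.+1) (c : R) k
    (M : 'M[R]_(p.+1, k.+1)) : 'M[R]_(p.+1, k.+1) :=
  \matrix_(x, y) (c + row_mean A x - row_mean A (s x) + M (s x) y).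

Section Twist.
Variables (p q : nat) (A : 'M[R]_(p.+1, q.+1)).
Implicit Types (s : 'S_p.+1) (t : 'S_q.+1) (c : R).

Lemma twist_trop_mul s c k l (M : 'M[R]_(p.+1, k.+1)) (X : 'M[R]_(k.+1, l.+1)) :
  twist A s c (trop_mul M X) = trop_mul (twist A s c M) X.
Proof.
apply/esym/trop_mul_eq => [x y z|x y]; rewrite [trop_mul]lock !mxE -lock.
  by have := trop_mul_ge M X (s x) y z; lra.
have [z eqz] := trop_mul_attained M X (s x) y.
by exists z; rewrite eqz !mxE; lra.
Qed.

Lemma twistM s c s' c' k (M : 'M[R]_(p.+1, k.+1)) :
  twist A (s * s')%g (c + c') M = twist A s c (twist A s' c' M).
Proof. by apply/matrixP => x y; rewrite !mxE permM; lra. Qed.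

Lemma twist1 k (M : 'M[R]_(p.+1, k.+1)) : twist A 1%g 0 M = M.
Proof. by apply/matrixP => x y; rewrite !mxE perm1; lra. Qed.

Lemma twist_left s c k (M : 'M[R]_(p.+1, k.+1)) :
  exists X, twist A s c M = trop_mul X M.
Proof.
have [x y|X <-] := @trop_factor _ p p k (twist A s c M) M; last by exists X.
by exists (s x) => y'; rewrite !mxE; lra.
Qed.

Lemma twist_right s t c :
  (forall x y, center A (s x) (t y) = center A x y) ->
  exists X, twist A s c A = trop_mul A X.
Proof.
move=> aut; have [x y|X <-] := @trop_factorr _ p q q (twist A s c A) A; last by exists X.
exists (t^-1%g y) => x'; rewrite !mxE !(center_decomp A).
by rewrite -[y](permKV t) !aut permK; do 2!move: (_ / _) => ?; lra.
Qed.

(** Centring removes the scalars of both descriptions of [B], which leaves an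
   automorphism; comparing them then shows that the row scalars differ from those
   of [twist] by a quantity depending neither on the row nor on the column. *)
Lemma monomial_twist (B : 'M[R]_(p.+1, q.+1)) (s : 'S_p.+1) (t : 'S_q.+1) l d :
  (forall x y, B x y = A (s x) y + l x) -> (forall x y, B x y = A x (t y) + d y) ->
  exists2 c, B = twist A s c A &
    forall x y, center A (s x) (t^-1%g y) = center A x y.
Proof.
move=> eqs eqt.
have centers x y : center A (s x) y = center A x (t y).
  have shift_s := @center_shift _ _ _ A B s 1%g l (fun=> 0).
  have shift_t := @center_shift _ _ _ A B 1%g t (fun=> 0) d.
  rewrite -[y in LHS](@perm1 _ y) -shift_s => [|x' y']; last by rewrite perm1 eqs addr0.
  by rewrite -[x in RHS](@perm1 _ x) -shift_t // => x' y'; rewrite perm1 eqt addr0.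
have cst x y : l x + row_mean A (s x) - row_mean A x =
               d y + col_rest A (t y) - col_rest A y.
  have := eqs x y; rewrite eqt (center_decomp A (s x)) (center_decomp A x) centers.
  by move: (_ / _) => ?; lra.
exists (l ord0 + row_mean A (s ord0) - row_mean A ord0).
  apply/matrixP => x y; rewrite mxE eqs (cst ord0 ord0) -(cst x ord0); lra.
by move=> x y; rewrite centers permKV.
Qed.

End Twist.

Section Schutzenberger.
Variables (n m p q : nat) (A : 'M[R]_(n.+1, m.+1)).
Variables (iota : 'I_p.+1 -> 'I_n.+1) (kappa : 'I_q.+1 -> 'I_m.+1).
Variable (L : 'M[R]_(n.+1, p.+1)).
Hypothesis L_rows : trop_mul L (rowsub iota A) = A.
Hypothesis cols : generates A^T (rowsub kappa A^T).
Let A1 := rowsub iota A.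
Let A' := mxsub iota kappa A.

(** Left multiplication by a matrix that would have infinite entries: select the
   core rows, twist them, and recompute all rows from these. *)
Definition core_op s c (B : 'M[R]_(n.+1, m.+1)) :=
  trop_mul L (twist A' s c (rowsub iota B)).

Let aut (s : 'S_p.+1) := exists t : 'S_q.+1, forall x y, center A' (s x) (t y) = center A' x y.

Lemma core_cols : exists Q, trop_mul (colsub kappa A) Q = A.
Proof.
apply: trop_factorr => i j; have [k sup] := cols j i; exists k => i'.
by have := sup i'; rewrite !mxE.
Qed.

Lemma core_op_trop_mul s c B X : core_op s c (trop_mul B X) = trop_mul (core_op s c B) X.
Proof. by rewrite /core_op rowsub_trop_mul twist_trop_mul trop_mulA. Qed.

Lemma core_op_left s c : exists X, core_op s c A = trop_mul X A.
Proof.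
have [X eqX] := twist_left A' s c A1.
have [x y|U eqU] := @trop_factor _ _ _ _ A1 A.
  by exists (iota x) => y'; rewrite !mxE addrC.
by exists (trop_mul L (trop_mul X U)); rewrite /core_op eqX -eqU !trop_mulA.
Qed.

Lemma twist_core_rows s c : aut s -> exists X, twist A' s c A1 = trop_mul A1 X.
Proof.
case=> t autst; have [Y eqY] := twist_right c autst.
have [Q eqQ] := core_cols.
have eqA1 : A1 = trop_mul A' Q.
  rewrite /A1 -{1}eqQ rowsub_trop_mul; congr trop_mul.
  by apply/matrixP => i j; rewrite !mxE.
have [x y|Z eqZ] := @trop_factorr _ _ _ _ A' A1.
  by exists (kappa y) => y'; rewrite !mxE addrC.
exists (trop_mul Z (trop_mul Y Q)).
by rewrite {1}eqA1 twist_trop_mul eqY -{1}eqZ !trop_mulA.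
Qed.

Lemma core_op_right s c : aut s ->
  exists2 X, core_op s c A = trop_mul A X & rowsub iota (core_op s c A) = twist A' s c A1.
Proof.
move=> auts; have [X eqX] := twist_core_rows c auts.
by exists X; rewrite /core_op eqX trop_mulA L_rows ?rowsub_trop_mul.
Qed.

Lemma core_opM s c s' c' : aut s' ->
  core_op (s * s')%g (c + c') A = core_op s c (core_op s' c' A).
Proof.
by move=> auts; have [X _ eqX] := core_op_right c' auts; rewrite {2}/core_op eqX -twistM.
Qed.

Lemma core_op1 : core_op 1%g 0 A = A.
Proof. by rewrite /core_op twist1. Qed.

Lemma autV s : aut s -> aut s^-1%g.
Proof. by case=> t autst; exists t^-1%g => x y; rewrite -autst !permKV. Qed.

Lemma core_opK s c : aut s -> core_op s^-1%g (- c) (core_op s c A) = A.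
Proof. by move=> auts; rewrite -core_opM // mulVg addNr core_op1. Qed.

Lemma core_opVK s c : aut s -> core_op s c (core_op s^-1%g (- c) A) = A.
Proof. by move=> /autV auts; rewrite -core_opM // mulgV addrN core_op1. Qed.

(** On [A] the operation is both a left and a right multiplication, and its inverse
   is an operation of the same kind. *)
Lemma core_op_greenH s c B : aut s ->
  greenH (mx_arrow A) (mx_arrow B) -> greenH (mx_arrow A) (mx_arrow (core_op s c B)).
Proof.
move=> auts /greenHP[_ /mx_arrow_inj <- [[[X eqB] [Y eqA]] [[Z eqB'] [W eqA']]]].
have [T eqT _] := core_op_right c auts.
have [T' eqT' _] := core_op_right (- c) (autV auts).
have [V eqV] := core_op_left s c; have [V' eqV'] := core_op_left s^-1%g (- c).
have B_left : trop_mul V' (core_op s c B) = B.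
  by rewrite eqB core_op_trop_mul eqT !trop_mulA -eqV' -core_op_trop_mul -eqT core_opK.
apply/greenHP; eexists; [by []|split; split].
- by exists (trop_mul T X); rewrite eqB core_op_trop_mul eqT trop_mulA.
- exists (trop_mul Y T').
  by rewrite -[LHS](core_opVK c auts) eqT' {1}eqA !core_op_trop_mul !trop_mulA.
- exists (trop_mul V Z).
  by rewrite {1}eqB core_op_trop_mul eqV -!trop_mulA -eqB eqB'.
- by exists (trop_mul W V'); rewrite -trop_mulA B_left.
Qed.

(** An element of the H-class is determined by its entries at the core, where the
   monomial lemma identifies it. *)
Lemma greenH_core_op B :
  irr_rows A' -> irr_rows A'^T -> greenH (mx_arrow A) (mx_arrow B) ->
  exists s c, aut s /\ B = core_op s c A.
Proof.
move=> irr_r irr_c /greenHP[_ /mx_arrow_inj <- [[[X eqB] [Y eqA]] [[Z eqB'] [W eqA']]]].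
have [Q eqQ] := core_cols.
have core_of (C : 'M[R]_(n.+1, m.+1)) : colsub kappa (rowsub iota C) = mxsub iota kappa C.
  by apply/matrixP => i j; rewrite !mxE.
have L_B : trop_mul L (rowsub iota B) = B.
  by rewrite eqB rowsub_trop_mul trop_mulA L_rows.
have B_Q : trop_mul (colsub kappa B) Q = B.
  by rewrite eqB' colsub_trop_mul -trop_mulA eqQ.
have L_B' : trop_mul L (mxsub iota kappa B) = colsub kappa B.
  by rewrite -[in RHS]L_B colsub_trop_mul core_of.
have L_A' : trop_mul L A' = colsub kappa A.
  by rewrite -[in RHS]L_rows colsub_trop_mul core_of.
have B'_Q : trop_mul (mxsub iota kappa B) Q = rowsub iota B.
  rewrite -[in RHS]B_Q rowsub_trop_mul; congr trop_mul.
  by apply/matrixP => i j; rewrite !mxE.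
have A'_Q : trop_mul A' Q = rowsub iota A.
  rewrite -[in RHS]eqQ rowsub_trop_mul; congr trop_mul.
  by apply/matrixP => i j; rewrite !mxE.
pose S := trop_mul (rowsub iota Z) L; pose S' := trop_mul (rowsub iota W) L.
have SA : trop_mul S A' = mxsub iota kappa B.
  by rewrite -trop_mulA L_A' -colsub_trop_mul -rowsub_trop_mul -eqB' core_of.
have S'B : trop_mul S' (mxsub iota kappa B) = A'.
  by rewrite -trop_mulA L_B' -colsub_trop_mul -rowsub_trop_mul -eqA' core_of.
pose T := trop_mul Q (colsub kappa X); pose T' := trop_mul Q (colsub kappa Y).
have AT : trop_mul A' T = mxsub iota kappa B.
  by rewrite trop_mulA A'_Q -colsub_trop_mul -rowsub_trop_mul -eqB core_of.
have BT' : trop_mul (mxsub iota kappa B) T' = A'.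
  by rewrite trop_mulA B'_Q -colsub_trop_mul -rowsub_trop_mul -eqA core_of.
have [|s [l eqs]] := @irr_rows_monomial _ _ _ A' S S' irr_r; first by rewrite SA.
have [|t [d eqt]] := @irr_rows_monomial _ _ _ A'^T T^T T'^T irr_c.
  by rewrite -!tr_trop_mul AT BT'.
have [x y|x y|c eqc auts] := @monomial_twist _ _ A' (mxsub iota kappa B) s t l d.
- by rewrite -SA eqs.
- by have := eqt y x; rewrite -tr_trop_mul AT !mxE.
exists s, c; split; first by exists t^-1%g.
by rewrite -[LHS]L_B -B'_Q eqc -twist_trop_mul A'_Q.
Qed.

Lemma core_op_inj s c s' c' : irr_rows A' -> aut s -> aut s' ->
  core_op s c A = core_op s' c' A -> s = s' /\ c = c'.
Proof.
move=> irr_r auts auts' eq_op.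
have [_ _ eq1] := core_op_right c auts; have [_ _ eq2] := core_op_right c' auts'.
have eq_tw x y : c + row_mean A' x - row_mean A' (s x) + A' (s x) y =
               c' + row_mean A' x - row_mean A' (s' x) + A' (s' x) y.
  have eq_A1 : twist A' s c A1 = twist A' s' c' A1 by rewrite -eq1 eq_op eq2.
  have := congr1 (fun M : 'M[R]_(p.+1, m.+1) => M x (kappa y)) eq_A1.
  by rewrite !mxE.
have eq_s : s = s'.
  apply/permP => x.
  pose d := c' - c + row_mean A' (s x) - row_mean A' (s' x).
  apply: (@irr_rows_inj _ _ _ A' _ _ d) => // y; rewrite /d.
  by have := eq_tw x y; lra.
by split=> //; have := eq_tw ord0 ord0; rewrite eq_s; lra.
Qed.

End Schutzenberger.

Lemma lmul_to_mx x n m (s : @hom1 (MFT R) x n) (B : 'M[R]_(n.+1, m.+1)) k :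
  lmul_to s (mx_arrow B) k -> k = @mx_arrow R x m (lmul1 s B).
Proof.
case=> z [b [eqb ->]]; have eq_z : z = m by case: eqb.
by subst z; have := mx_arrow_inj eqb => ->.
Qed.

Lemma lmul1_trop_mul x n m k (s : @hom1 (MFT R) x n)
    (B : 'M[R]_(n.+1, m.+1)) (T : 'M[R]_(m.+1, k.+1)) :
  lmul1 s (trop_mul B T : @Defs.hom (MFT R) n k) = trop_mul (lmul1 s B : 'M[R]_(x.+1, m.+1)) T.
Proof. by move: B; case: _ / s => [n' X|_] B //=; rewrite trop_mulA. Qed.

(** The operations [core_op] multiply like pairs of a permutation and a real
   number, and a member of the Schutzenberger group is determined by the image of
   [A], which one of them attains. *)
Theorem schutzenberger_core (n m p q : nat) (A : 'M[R]_(n.+1, m.+1))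
    (iota : 'I_p.+1 -> 'I_n.+1) (kappa : 'I_q.+1 -> 'I_m.+1)
    (gT : finGroupType) (G : {group gT}) (rho : gT -> 'S_p.+1 * 'S_q.+1) :
  generates A (rowsub iota A) -> generates A^T (rowsub kappa A^T) ->
  realizes G (mxsub iota kappa A) rho ->
  schutzenberger_iso_prod (greenH (mx_arrow A)) G.
Proof.
move=> rows cols [irr_r irr_c rhoM rho_inj autP].
have [L eqL] := trop_factor rows.
pose H : set (arrow (MFT R)) := greenH (mx_arrow A).
pose aut (s : 'S_p.+1) := exists t : 'S_q.+1, forall x y,
  center (mxsub iota kappa A) (s x) (t y) = center (mxsub iota kappa A) x y.
have aut_rho (u : subg_of G) : aut (rho (sgval u)).1.
  by exists (rho (sgval u)).2; apply/autP; exists (sgval u); rewrite ?subgP.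
have mxP (h : H) : val h = mx_arrow (arrow_mx n m (val h)).
  by have /set_mem/greenHP[B ->] := valP h; rewrite mx_arrowK.
have HP (h : H) : greenH (mx_arrow A) (mx_arrow (arrow_mx n m (val h))).
  by rewrite -mxP; exact: set_mem (valP h).
pose op (u : subg_of G * R) := @core_op n m p q A iota kappa L (rho (sgval u.1)).1 u.2.
have opH u (h : H) : mx_arrow (op u (arrow_mx n m (val h))) \in H.
  by apply/mem_set; exact: (core_op_greenH eqL cols u.2 (aut_rho u.1) (HP h)).
pose f u : H -> H := fun h => exist (fun x => x \in H) _ (opH u h).
have H_ext (h h' : H) : arrow_mx n m (val h) = arrow_mx n m (val h') -> h = h'.
  by move=> eq_h; apply/val_inj; rewrite mxP eq_h -mxP.
have fE u h : arrow_mx n m (val (f u h)) = op u (arrow_mx n m (val h)).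
  by rewrite /= mx_arrowK.
have A_H : mx_arrow A \in H by apply/mem_set.
pose a : H := exist (fun x => x \in H) _ A_H.
have aE : arrow_mx n m (val a) = A by rewrite /= mx_arrowK.
have gen_A (h : H) : exists T, arrow_mx n m (val h) = trop_mul A T.
  by have /greenHP[B /mx_arrow_inj-> [[]]] := HP h.
exists f; split.
- move=> [g c] [g' c'] eq_f.
  have : op (g, c) A = op (g', c') A by rewrite -aE -!fE eq_f.
  case/(core_op_inj eqL cols irr_r (aut_rho g) (aut_rho g')) => /= eq_1 ->.
  congr (_, _); apply/val_inj/rho_inj; rewrite ?subgP //.
  have autg : forall k : subg_of G, exists2 k', k' \in G & rho (sgval k) = rho k'.
    by move=> k; exists (sgval k); rewrite ?subgP.
  move: (autg g) (autg g') eq_1 => /autP + /autP.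
  case: (rho _) => s t; case: (rho _) => s' t' /= aut1 aut2 eq_s.
  by rewrite -eq_s in aut2 *; rewrite (irr_cols_aut_inj irr_c aut1 aut2).
- apply/seteqP; split=> [_ [u _ <-]|phi [x [y [s phiP]]]].
    have [X eqX] := @core_op_left n m p q A iota kappa L (rho (sgval u.1)).1 u.2.
    exists n, n, (@OldArrow (MFT R) n n X) => h.
    exists m, (arrow_mx n m (val h)); split; first exact: mxP.
    have [T eqT] := gen_A h; congr mx_arrow.
    by rewrite /= /op eqT core_op_trop_mul eqX trop_mulA.
  have [z [b [eqb _]]] := phiP a; have eq_y : y = n by case: eqb.
  subst y; clear z b eqb.
  have eq_phi (h : H) := lmul_to_mx (eq_ind _ (fun k => lmul_to s k _) (phiP h) _ (mxP h)).
  have eq_x : x = n.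
    have eq_dom := congr1 (@Defs.dom _) (eq_phi a); rewrite (mxP (phi a)) in eq_dom.
    exact: esym eq_dom.
  subst x.
  have eq_mx (h : H) : arrow_mx n m (val (phi h)) = lmul1 s (arrow_mx n m (val h)).
    by rewrite {1}eq_phi mx_arrowK.
  have H_sA := HP (phi a); rewrite eq_mx aE in H_sA.
  have [s0 [c [[t autst] eq_op]]] := greenH_core_op eqL cols irr_r irr_c H_sA.
  have /autP[g Gg eq_g] := autst : forall x y, center _ ((s0, t).1 x) ((s0, t).2 y) = _.
  exists (subg G g, c) => //; apply/funext => h; apply/H_ext.
  rewrite fE eq_mx; have [T ->] := gen_A h.
  by rewrite lmul1_trop_mul eq_op /op core_op_trop_mul /= subgK // -eq_g.
- move=> u v; apply/funext => h; apply/H_ext.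
  rewrite /comp !fE; have [T ->] := gen_A h.
  rewrite /op !core_op_trop_mul -core_opM //; last exact: (aut_rho v.1).
  have := rhoM (sgval u.1) (sgval v.1) (subgP _) (subgP _).
  by rewrite -sgvalM ?finset.in_setT // => ->.
Qed.

End Core.

(** * Existence of a core *)

Section CoreExistence.
Variable R : realType.

(** A smallest generating family of rows is irredundant: a row that is redundant in
   each column could be dropped, since supporting rows compose. *)
Lemma irr_generating_rows n m (A : 'M[R]_(n.+1, m.+1)) :
  exists p (iota : 'I_p.+1 -> 'I_n.+1),
    generates A (rowsub iota A) /\ irr_rows (rowsub iota A).
Proof.
pose P p := `[< exists iota : 'I_p.+1 -> 'I_n.+1, generates A (rowsub iota A) >].
have exP : exists p, P p.
  exists n; apply/asboolP; exists id => i j; exists i => j'.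
  by rewrite !mxE addrC.
have [p /asboolP[iota gen_iota] min_p] := ex_minnP exP.
exists p, iota; split=> //; apply: contrapT => /existsNP[x] /forallNP irrN.
have red y : exists2 x', x' != x & supports (rowsub iota A) (rowsub iota A) x x' y.
  apply: contrapT => red_y; apply: (irrN y) => x' ne_x' sup_x'.
  by apply: red_y; exists x'.
case: p => [|p] in iota gen_iota x min_p irrN red *.
  by have [x'] := red ord0; rewrite !ord1.
suff /min_p : P p by rewrite ltnn.
apply/asboolP; exists (iota \o lift x) => i j.
have sub k : k != x -> supports A (rowsub iota A) i k j ->
    exists l, supports A (rowsub (iota \o lift x) A) i l j.
  rewrite eq_sym => /unlift_some[l -> _] sup_l; exists l => j'.
  by have := sup_l j'; rewrite !mxE.
have [k sup_k] := gen_iota i j.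
have [eq_k|] := eqVneq k x; last by move/sub; apply.
have [x' ne_x' sup_x'] := red j; apply: sub ne_x' _.
by apply: supports_trans sup_k _; rewrite eq_k.
Qed.

(** A witness of irredundancy can be moved to a supporting column, so it survives
   the restriction to a generating family of columns. *)
Lemma irr_rows_colsub n m q (A : 'M[R]_(n, m)) (kappa : 'I_q -> 'I_m) :
  irr_rows A -> generates A^T (rowsub kappa A^T) -> irr_rows (colsub kappa A).
Proof.
move=> irrA gen x; have [y irr_y] := irrA x.
have [k sup_k] := gen y x; exists k => x' ne_x' sup_x'.
apply: (irr_y x' ne_x') => y'; have [k' sup_k'] := gen y' x'.
have := sup_k x'; have := sup_k' x; have := sup_x' k'.
by rewrite !mxE; lra.
Qed.

Lemma exists_core n m (A : 'M[R]_(n.+1, m.+1)) :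
  exists p q (iota : 'I_p.+1 -> 'I_n.+1) (kappa : 'I_q.+1 -> 'I_m.+1),
    [/\ generates A (rowsub iota A), generates A^T (rowsub kappa A^T),
        irr_rows (mxsub iota kappa A) & irr_rows (mxsub iota kappa A)^T].
Proof.
have [p [iota [gen_r irr_r]]] := irr_generating_rows A.
have [q [kappa [gen_c irr_c]]] := irr_generating_rows A^T.
exists p, q, iota, kappa; split=> //.
- have <- : colsub kappa (rowsub iota A) = mxsub iota kappa A.
    by apply/matrixP => i j; rewrite !mxE.
  apply: irr_rows_colsub => // j i; have [k sup_k] := gen_c j (iota i).
  by exists k => i'; have := sup_k (iota i'); rewrite !mxE.
- have <- : colsub iota (rowsub kappa A^T) = (mxsub iota kappa A)^T.
    by apply/matrixP => i j; rewrite !mxE.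
  apply: irr_rows_colsub => // i j; have [k sup_k] := gen_r i (kappa j).
  by exists k => j'; have := sup_k (kappa j'); rewrite !mxE.
Qed.

Lemma irr_rows_injective n m p (A : 'M[R]_(n, m)) (iota : 'I_p -> 'I_n) :
  irr_rows (rowsub iota A) -> injective iota.
Proof.
move=> irrA x x' eq_x; apply: (@irr_rows_inj _ _ _ _ _ _ 0 irrA) => y.
by rewrite !mxE eq_x addr0.
Qed.

End CoreExistence.

(** * Paired 2-closed representations on ordinals *)

Section PairedRepresentations.
Variables (gT : finGroupType) (G : {group gT}).

Definition paired_rep a b (r : gT -> 'S_a * 'S_b) :=
  [/\ {in G &, {morph r : g h / (g * h)%g}},
      {in G &, injective (fun g => (r g).1)},
      {in G &, injective (fun g => (r g).2)}
    & forall u : 'S_a * 'S_b,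
        (forall x y, exists2 g, g \in G & u.1 x = (r g).1 x /\ u.2 y = (r g).2 y) ->
        exists2 g, g \in G & u = r g].

Section Orbits.
Variables (Omega Gamma : finType) (toO : action G Omega) (toG : action G Gamma).

Lemma preserves_pair_orbitsP u :
  preserves_pair_orbits toO toG u <->
  forall x y, exists2 g, g \in G & u.1 x = toO x g /\ u.2 y = toG y g.
Proof.
pose D := diagonal_image toO toG.
have orbP (x x' : Omega) (y y' : Gamma) :
    reflect (exists2 g, g \in G & x' = toO x g /\ y' = toG y g)
      ((x', y') \in orbit (pair_action Omega Gamma) D (x, y)).
  apply: (iffP orbitP) => [[_ /imsetP[g Gg ->]]|[g Gg [-> ->]]].
    by rewrite /= /pair_act /= !actpermE => -[<- <-]; exists g.
  exists (actperm toO g, actperm toG g); first exact: imset_f.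
  by rewrite /= /pair_act /= !actpermE.
split=> [pres x y|pres [x y] O].
  apply/orbP; rewrite -(pres (x, y)); apply/imsetP; exists (x, y) => //.
  by apply/orbP; exists 1%g; rewrite ?act1 ?group1.
apply/eqP; rewrite eqEcard card_imset; last first.
  by move=> [x1 y1] [x2 y2] [/perm_inj -> /perm_inj ->].
rewrite leqnn andbT; apply/fintype.subsetP => _ /imsetP[[x' y'] /orbP[g Gg [-> ->]] ->].
have [h Gh [eq1 eq2]] := pres (toO x g) (toG y g); rewrite /pair_act /= eq1 eq2.
by apply/orbP; exists (g * h)%g; rewrite ?groupM // !actMin.
Qed.

End Orbits.

Lemma faithful_onP (T : finType) (to : action G T) :
  [faithful G, on [set: T] | to] <->
  forall g, g \in G -> (forall x, to x g = x) -> g = 1%g.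
Proof.
split=> [/fintype.subsetP faith g Gg fix_g|faith].
  apply/set1gP/faith; rewrite !inE Gg /=.
  by apply/fintype.subsetP => x _; rewrite inE fix_g.
apply/fintype.subsetP => g; rewrite !inE => /and3P[Gg _ /fintype.subsetP fix_g].
by apply/eqP/faith => // x; apply/eqP; have := fix_g x; rewrite !inE; apply.
Qed.

Lemma paired_rep_has_rep a b (r : gT -> 'S_a * 'S_b) :
  paired_rep r -> has_paired_2closed_rep G a b.
Proof.
case=> rM inj1 inj2 closed.
have act1P : is_action G (fun x g => (r g).1 x).
  by split=> [g x x' /perm_inj //|g h Gg Gh x]; rewrite rM // permM.
have act2P : is_action G (fun y g => (r g).2 y).
  by split=> [g y y' /perm_inj //|g h Gg Gh y]; rewrite rM // permM.
have r1 : r 1%g = 1%g.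
  by apply: (mulgI (r 1%g)); rewrite mulg1 -rM ?group1 // mulg1.
exists 'I_a, 'I_b, (Action act1P), (Action act2P); split; rewrite ?card_ord //.
- apply/faithful_onP => g Gg fix_g; apply: inj1; rewrite ?group1 // r1.
  by apply/permP => x; rewrite perm1; exact: fix_g.
- apply/faithful_onP => g Gg fix_g; apply: inj2; rewrite ?group1 // r1.
  by apply/permP => x; rewrite perm1; exact: fix_g.
move=> u /preserves_pair_orbitsP pres; have [g Gg ->] := closed u pres.
apply/imsetP; exists g => //; rewrite [LHS]surjective_pairing.
by congr (_, _); apply/permP => x; rewrite actpermE.
Qed.

Lemma faithful_act_inj (T : finType) (to : action G T) :
  [faithful G, on [set: T] | to] ->
  {in G &, forall g h, to^~ g =1 to^~ h -> g = h}.
Proof.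
move=> /faithful_onP faith g h Gg Gh eq_gh; apply/eqP; rewrite eq_mulgV1; apply/eqP.
apply: faith => [|x]; first by rewrite groupM ?groupV.
by rewrite actMin ?groupV // eq_gh -actMin ?groupV // mulgV act1.
Qed.

Lemma has_rep_paired_rep a b :
  has_paired_2closed_rep G a b -> exists r : gT -> 'S_a * 'S_b, paired_rep r.
Proof.
case=> Omega [Gamma [toO [toG [cardO cardG faithO faithG closed]]]]; subst a b.
have inj (T : finType) (to : action G T) g :
    injective (fun i : 'I_#|T| => enum_rank (to (enum_val i) g)).
  by move=> i i' /enum_rank_inj /act_inj /enum_val_inj.
pose r g : 'S_#|Omega| * 'S_#|Gamma| := (perm (inj _ toO g), perm (inj _ toG g)).
exists r; split.
- move=> g h Gg Gh; congr (_, _); apply/permP => i;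
  by rewrite permM !permE /= actMin // enum_rankK.
- move=> g h Gg Gh /permP eq_gh; apply: (faithful_act_inj faithO) => // x.
  by have := eq_gh (enum_rank x); rewrite !permE !enum_rankK => /enum_rank_inj.
- move=> g h Gg Gh /permP eq_gh; apply: (faithful_act_inj faithG) => // x.
  by have := eq_gh (enum_rank x); rewrite !permE !enum_rankK => /enum_rank_inj.
move=> u pres.
have injV (T : finType) (s : 'S_#|T|) : injective (fun x => enum_val (s (enum_rank x))).
  by move=> x x' /enum_val_inj /perm_inj /enum_rank_inj.
have /closed/imsetP[g Gg [eq1 eq2]] :
    preserves_pair_orbits toO toG (perm (injV _ u.1), perm (injV _ u.2)).
  apply/preserves_pair_orbitsP => x y.
  have [g Gg] := pres (enum_rank x) (enum_rank y); rewrite /r /= !permE !enum_rankK => -[e1 e2].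
  by exists g; rewrite // e1 e2 !enum_rankK.
exists g => //; rewrite [LHS]surjective_pairing; congr (_, _); apply/permP => i.
  have /permP/(_ (enum_val i)) := eq1; rewrite actpermE !permE enum_valK => <-.
  by rewrite enum_valK.
have /permP/(_ (enum_val i)) := eq2; rewrite actpermE !permE enum_valK => <-.
by rewrite enum_valK.
Qed.

End PairedRepresentations.

(** * From H-classes to paired 2-closed groups *)

Section ExtendPerm.
Variables (p n : nat) (iota : 'I_p -> 'I_n).
Hypothesis iota_inj : injective iota.

Definition ext_fun (s : 'S_p) i :=
  if [pick x | iota x == i] is Some x then iota (s x) else i.

Lemma ext_fun_iota s x : ext_fun s (iota x) = iota (s x).
Proof. by rewrite /ext_fun; case: pickP => [z /eqP/iota_inj-> //|/(_ x)]; rewrite eqxx. Qed.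

Lemma ext_funM s t i : ext_fun t (ext_fun s i) = ext_fun (s * t)%g i.
Proof.
rewrite {2}/ext_fun; case: (pickP (fun x => iota x == i)) => [x /eqP <-|no_x].
  by rewrite !ext_fun_iota permM.
by rewrite /ext_fun; case: pickP => // x; rewrite no_x.
Qed.

Lemma ext_fun1 i : ext_fun 1%g i = i.
Proof. by rewrite /ext_fun; case: pickP => // x /eqP <-; rewrite perm1. Qed.

Lemma ext_fun_inj s : injective (ext_fun s).
Proof. by apply: (can_inj (g := ext_fun s^-1%g)) => i; rewrite ext_funM mulgV ext_fun1. Qed.

Definition ext_perm s : 'S_n := perm (@ext_fun_inj s).

Lemma ext_perm_iota s x : ext_perm s (iota x) = iota (s x).
Proof. by rewrite permE ext_fun_iota. Qed.

Lemma ext_permM : {morph ext_perm : s t / (s * t)%g}.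
Proof. by move=> s t; apply/permP => i; rewrite permM !permE ext_funM. Qed.

Lemma ext_perm_inj : injective ext_perm.
Proof.
move=> s t /permP eq_st; apply/permP => x; apply: iota_inj.
by rewrite -!ext_perm_iota eq_st.
Qed.

Lemma ext_perm_local (u : 'S_n) :
  (forall i, exists s, u i = ext_perm s i) -> exists s, u = ext_perm s.
Proof.
move=> loc.
have img x : exists z, u (iota x) = iota z.
  by have [s ->] := loc (iota x); exists (s x); rewrite ext_perm_iota.
have [f fP] := choice img.
have f_inj : injective f.
  by move=> x x' eq_f; apply/iota_inj/(@perm_inj _ u); rewrite !fP eq_f.
exists (perm f_inj); apply/permP => i; have [s us] := loc i; rewrite us !permE.
rewrite /ext_fun; case: pickP => // x /eqP eq_x; rewrite permE -fP eq_x us permE.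
by rewrite -eq_x ext_fun_iota.
Qed.

End ExtendPerm.

Section HClassToGroup.
Variable R : realType.

Definition center_aut p q (A : 'M[R]_(p, q)) : {set 'S_p * 'S_q} :=
  [set u : 'S_p * 'S_q | [forall x, [forall y, center A (u.1 x) (u.2 y) == center A x y]]].

Lemma center_autP p q (A : 'M[R]_(p, q)) (u : 'S_p * 'S_q) :
  reflect (forall x y, center A (u.1 x) (u.2 y) = center A x y) (u \in center_aut A).
Proof.
rewrite inE; apply: (iffP forallP) => [autu x y|autu x].
  by have /forallP/(_ y)/eqP := autu x.
by apply/forallP => y; apply/eqP.
Qed.

Lemma center_aut_group_set p q (A : 'M[R]_(p, q)) : group_set (center_aut A).
Proof.
apply/group_setP; split=> [|u v /center_autP autu /center_autP autv].
  by apply/center_autP => x y; rewrite /= !perm1.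
by apply/center_autP => x y; rewrite /= !permM autv autu.
Qed.

Canonical center_aut_group p q (A : 'M[R]_(p, q)) := group (center_aut_group_set A).

(** Indices outside the images of [iota] and [kappa] are fixed by the extended
   permutations, hence by whatever preserves their orbits of pairs; on the images,
   preserving orbits implies preserving the entries of the centred matrix. *)
Lemma irr_realizes p q (A : 'M[R]_(p.+1, q.+1)) n m
    (iota : 'I_p.+1 -> 'I_n) (kappa : 'I_q.+1 -> 'I_m) :
  injective iota -> injective kappa -> irr_rows A -> irr_rows A^T ->
  exists (G : {group 'S_n}) (rho : 'S_n -> 'S_p.+1 * 'S_q.+1),
    realizes G A rho /\ exists r : 'S_n -> 'S_n * 'S_m, paired_rep G r.
Proof.
move=> iota_inj kappa_inj irr_r irr_c.
pose K := [group of center_aut A].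
pose f (u : 'S_p.+1 * 'S_q.+1) := ext_perm iota_inj u.1.
have fM : {in K &, {morph f : u v / (u * v)%g}}.
  by move=> u v _ _; rewrite /f -ext_permM.
pose fm := Morphism fM.
have fm_inj : ('injm fm)%g.
  apply/injmP => -[s t] [s' t'] /center_autP aut1 /center_autP aut2 /ext_perm_inj /= eq_s.
  by rewrite -eq_s in aut2 *; have /= -> := irr_cols_aut_inj irr_c aut1 aut2.
pose G := (fm @* K)%G; pose rho := invm fm_inj.
have rhoM : {in G &, {morph rho : g h / (g * h)%g}} by exact: morphM.
have rho_inj : {in G &, injective rho} by apply/injmP; exact: injm_invm.
have rho_aut g x y : g \in G -> center A ((rho g).1 x) ((rho g).2 y) = center A x y.
  by move=> /morphimP[u Ku _ ->]; rewrite /rho invmE //; apply/center_autP.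
have autP (u : 'S_p.+1 * 'S_q.+1) : (forall x y, center A (u.1 x) (u.2 y) = center A x y) ->
    exists2 g, g \in G & u = rho g.
  move=> /center_autP Ku; exists (fm u); first exact: mem_morphim.
  by rewrite /rho invmE.
exists G, rho; split; first by split=> // u; split=> [/autP //|[g Gg ->] x y]; exact: rho_aut.
exists (fun g => (ext_perm iota_inj (rho g).1, ext_perm kappa_inj (rho g).2)); split.
- by move=> g h Gg Gh; rewrite rhoM //= !ext_permM.
- move=> g h Gg Gh /ext_perm_inj /= eq1; apply: rho_inj => //.
  rewrite [LHS]surjective_pairing [RHS]surjective_pairing eq1; congr (_, _).
  apply: (irr_cols_aut_inj (s := (rho h).1) irr_c) => x y; last exact: rho_aut.
  by rewrite -eq1; exact: rho_aut.
- move=> g h Gg Gh /ext_perm_inj /= eq2; apply: rho_inj => //.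
  rewrite [LHS]surjective_pairing [RHS]surjective_pairing eq2; congr (_, _).
  apply: (irr_rows_aut_inj (t := (rho h).2) irr_r) => x y; last exact: rho_aut.
  by rewrite -eq2; exact: rho_aut.
case=> u1 u2 /= loc.
have [i|s eq_s] := @ext_perm_local _ _ iota iota_inj u1.
  by have [g _ [-> _]] := loc i (kappa ord0); exists (rho g).1.
have [j|t eq_t] := @ext_perm_local _ _ kappa kappa_inj u2.
  by have [g _ [_ ->]] := loc (iota ord0) j; exists (rho g).2.
have [x y|g Gg eq_g] := autP (s, t).
  have [g Gg] := loc (iota x) (kappa y); rewrite eq_s eq_t !ext_perm_iota /=.
  by case=> /iota_inj-> /kappa_inj->; exact: rho_aut.
by exists g => //; rewrite -eq_g eq_s eq_t.
Qed.

Theorem Hclass_schutzenberger n m (A : 'M[R]_(n.+1, m.+1)) :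
  exists G : {group 'S_n.+1},
    has_paired_2closed_rep G n.+1 m.+1 /\
    schutzenberger_iso_prod (greenH (mx_arrow A)) G.
Proof.
have [p [q [iota [kappa [gen_r gen_c irr_r irr_c]]]]] := exists_core A.
have iota_inj : injective iota.
  apply: (@irr_rows_injective _ _ _ _ (colsub kappa A)).
  by rewrite (_ : rowsub _ _ = mxsub iota kappa A) //; apply/matrixP => i j; rewrite !mxE.
have kappa_inj : injective kappa.
  apply: (@irr_rows_injective _ _ _ _ (colsub iota A^T)).
  by rewrite (_ : rowsub _ _ = (mxsub iota kappa A)^T) //; apply/matrixP => i j; rewrite !mxE.
have [G [rho [realG [r rep_r]]]] := irr_realizes iota_inj kappa_inj irr_r irr_c.
exists G; split; first exact: paired_rep_has_rep rep_r.
exact: schutzenberger_core realG.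
Qed.

End HClassToGroup.

(** * Removing superfluous columns from a representation *)

Section Reduction.
Variables (gT : finGroupType) (G : {group gT}).

Definition sim a b (r : gT -> 'S_a * 'S_b) x y x' y' :=
  exists2 g, g \in G & x' = (r g).1 x /\ y' = (r g).2 y.

Definition rep_morph a b (r : gT -> 'S_a * 'S_b) :=
  {in G &, {morph r : g h / (g * h)%g}}.

Definition swap_rep a b (r : gT -> 'S_a * 'S_b) g := ((r g).2, (r g).1).

Section Sim.
Variables (a b : nat) (r : gT -> 'S_a * 'S_b).
Hypothesis rM : rep_morph r.

Lemma rep1 : r 1%g = 1%g.
Proof. by apply: (mulgI (r 1%g)); rewrite mulg1 -rM ?group1 // mulg1. Qed.

Lemma rep1M g h x : g \in G -> h \in G -> (r (g * h)%g).1 x = (r h).1 ((r g).1 x).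
Proof. by move=> Gg Gh; rewrite rM // permM. Qed.

Lemma rep2M g h y : g \in G -> h \in G -> (r (g * h)%g).2 y = (r h).2 ((r g).2 y).
Proof. by move=> Gg Gh; rewrite rM // permM. Qed.

Lemma rep1K g x : g \in G -> (r g^-1%g).1 ((r g).1 x) = x.
Proof. by move=> Gg; rewrite -rep1M ?groupV // mulgV rep1 perm1. Qed.

Lemma rep2K g y : g \in G -> (r g^-1%g).2 ((r g).2 y) = y.
Proof. by move=> Gg; rewrite -rep2M ?groupV // mulgV rep1 perm1. Qed.

Lemma sim_act g x y : g \in G -> sim r x y ((r g).1 x) ((r g).2 y).
Proof. by exists g. Qed.

Lemma sim_refl x y : sim r x y x y.
Proof. by exists 1%g; rewrite ?group1 // rep1 !perm1. Qed.

Lemma sim_sym x y x' y' : sim r x y x' y' -> sim r x' y' x y.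
Proof. by case=> g Gg [-> ->]; exists g^-1%g; rewrite ?groupV // rep1K // rep2K. Qed.

Lemma sim_trans x y x' y' x'' y'' :
  sim r x y x' y' -> sim r x' y' x'' y'' -> sim r x y x'' y''.
Proof.
case=> g Gg [-> ->] [h Gh [-> ->]]; exists (g * h)%g; first exact: groupM.
by rewrite rep1M // rep2M.
Qed.

End Sim.

Lemma sim_swap a b (r : gT -> 'S_a * 'S_b) x y x' y' :
  sim (swap_rep r) y x y' x' <-> sim r x y x' y'.
Proof. by split=> -[g Gg [e1 e2]]; exists g. Qed.

Lemma paired_rep_swap a b (r : gT -> 'S_a * 'S_b) :
  paired_rep G r -> paired_rep G (swap_rep r).
Proof.
case=> rM inj1 inj2 closed; split=> //.
  by move=> g h Gg Gh; rewrite /swap_rep rM.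
case=> u2 u1 loc; have [x y|g Gg eq_g] := closed (u1, u2).
  by have [g Gg [e2 e1]] := loc y x; exists g.
by exists g => //; rewrite /swap_rep -eq_g.
Qed.

(** Transposing two columns with the same entries preserves all orbits of pairs,
   yet fixes every row. *)
Lemma distinct_cols a b (r : gT -> 'S_a * 'S_b) y y' :
  paired_rep G r -> (forall x, sim r x y x y') -> y = y'.
Proof.
move=> [rM inj1 inj2 closed] eq_yy'.
have [x z|g Gg eq_g] := closed (1%g, tperm y y').
  have [g Gg [e1 e2]] : sim r x z x (tperm y y' z).
    case: tpermP => [->|->|_ _] //; first exact: sim_sym.
    exact: sim_refl.
  by exists g; rewrite // perm1.
have g1 : g = 1%g by apply: inj1; rewrite ?group1 // -eq_g rep1.
have := congr1 (fun u : 'S_a * 'S_b => u.2 y) eq_g.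
by rewrite g1 rep1 // perm1 tpermL.
Qed.

Lemma distinct_rows a b (r : gT -> 'S_a * 'S_b) x x' :
  paired_rep G r -> (forall y, sim r x y x' y) -> x = x'.
Proof.
by move=> /paired_rep_swap/distinct_cols eq_xx' sim_xx'; apply: eq_xx' => y; apply/sim_swap.
Qed.

(** Closure can be tested on row permutations alone: when columns are distinct,
   the column permutation is determined by the row permutation. *)
Lemma paired_rep_col_closed a b (r : gT -> 'S_a * 'S_b) (s : 'S_a) :
  paired_rep G r ->
  (forall y, exists y', forall x, sim r x y (s x) y') ->
  exists2 g, g \in G & s = (r g).1.
Proof.
move=> rep_r /choice[f fP]; have [rM inj1 inj2 closed] := rep_r.
have f_inj : injective f.
  move=> y y' eq_f; apply: (distinct_cols rep_r) => x.
  by apply: (sim_trans rM (fP y x)); rewrite eq_f; exact: sim_sym (fP y' x).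
have [x y|g Gg eq_g] := closed (s, perm f_inj).
  by have [g Gg [e1 e2]] := fP y x; exists g; rewrite //= permE.
by exists g; rewrite // -eq_g.
Qed.

Lemma col_closed_paired_rep a b (r : gT -> 'S_a * 'S_b) :
  rep_morph r ->
  {in G &, injective (fun g => (r g).1)} -> {in G &, injective (fun g => (r g).2)} ->
  (forall y y', (forall x, sim r x y x y') -> y = y') ->
  (forall s : 'S_a, (forall y, exists y', forall x, sim r x y (s x) y') ->
     exists2 g, g \in G & s = (r g).1) ->
  paired_rep G r.
Proof.
move=> rM inj1 inj2 dist closed; split=> //; case=> s t /= loc.
have simP x y : sim r x y (s x) (t y) by have [g Gg e] := loc x y; exists g.
have [y|g Gg eq_s] := closed s; first by exists (t y).
exists g => //; rewrite [RHS]surjective_pairing -eq_s; congr (_, _).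
apply/permP => y; apply: dist => x.
have := simP (s^-1%g x) y; rewrite permKV => /(sim_sym rM) sim1.
apply: (sim_trans rM sim1).
by have := @sim_act _ _ r g (s^-1%g x) y Gg; rewrite -eq_s permKV.
Qed.

(** By the criterion in terms of row permutations, a dropped column matters only
   through the condition that it imposes on these. *)
Lemma paired_rep_drop_cols a b b' (r : gT -> 'S_a * 'S_b) (kappa : 'I_b' -> 'I_b) :
  paired_rep G r -> injective kappa ->
  (forall g z, g \in G -> exists z', (r g).2 (kappa z) = kappa z') ->
  {in G &, forall g h, (forall z, (r g).2 (kappa z) = (r h).2 (kappa z)) -> g = h} ->
  (forall s : 'S_a,
     (forall z, exists z', forall x, sim r x (kappa z) (s x) (kappa z')) ->
     forall y, exists y', forall x, sim r x y (s x) y') ->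
  exists r' : gT -> 'S_a * 'S_b', paired_rep G r'.
Proof.
move=> rep_r kappa_inj stab faith drop; have [rM inj1 inj2 closed] := rep_r.
have restr g : exists t : 'S_b', g \in G -> forall z, (r g).2 (kappa z) = kappa (t z).
  have [Gg|] := boolP (g \in G); last by exists 1%g.
  have [f fP] := choice (fun z => stab g z Gg).
  have f_inj : injective f.
    by move=> z z' eq_f; apply/kappa_inj/(@perm_inj _ (r g).2); rewrite !fP eq_f.
  by exists (perm f_inj) => _ z; rewrite permE.
have [t tP] := choice restr.
pose r' g := ((r g).1, t g).
have simP x z x' z' : sim r' x z x' z' <-> sim r x (kappa z) x' (kappa z').
  split=> -[g Gg [e1 e2]]; exists g => //; split=> //; first by rewrite tP // e2.
  by apply: kappa_inj; rewrite e2 tP.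
exists r'; apply: col_closed_paired_rep => //.
- move=> g h Gg Gh; rewrite /r' rM //; congr (_, _); apply/permP => z.
  by apply: kappa_inj; rewrite permM -!tP ?groupM // rep2M.
- move=> g h Gg Gh /= eq_t; apply: faith => // z; by rewrite !tP // eq_t.
- move=> z z' sim_z; apply/kappa_inj/(distinct_cols rep_r) => x.
  by apply/simP.
move=> s s_loc; apply: (paired_rep_col_closed rep_r); apply: drop => z.
by have [z' sim_z] := s_loc z; exists z' => x; apply/simP.
Qed.

(** A fixed column only records the orbits on rows, which any other column
   records as well. *)
Lemma paired_rep_drop_fixed a b (r : gT -> 'S_a * 'S_b.+2) y0 :
  paired_rep G r -> (forall g, g \in G -> (r g).2 y0 = y0) ->
  exists r' : gT -> 'S_a * 'S_b.+1, paired_rep G r'.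
Proof.
move=> rep_r fix_y0; have [rM inj1 inj2 closed] := rep_r.
apply: (paired_rep_drop_cols rep_r (@lift_inj _ y0)) => [g z Gg|g h Gg Gh eq_gh|s loc y].
- have : y0 != (r g).2 (lift y0 z).
    by rewrite -{1}(fix_y0 g Gg) (inj_eq perm_inj) neq_lift.
  by case/unlift_some => z' ->; exists z'.
- apply: inj2 => //; apply/permP => y.
  by case: (unliftP y0 y) => [z ->|->]; [exact: eq_gh | rewrite !fix_y0].
case: (unliftP y0 y) => [z ->|->].
  by have [z' sim_z] := loc z; exists (lift y0 z').
exists y0 => x; have [z' /(_ x)[g Gg [e _]]] := loc ord0.
by exists g; rewrite ?fix_y0.
Qed.

Lemma set_enum n (D : {set 'I_n}) y : y \in D ->
  exists k (kappa : 'I_k.+1 -> 'I_n),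
    [/\ #|D| = k.+1, injective kappa & forall z, z \in D <-> exists i, z = kappa i].
Proof.
move=> Dy; case def_k: #|D| => [|k]; first by move: Dy; rewrite (cards0_eq def_k) inE.
exists k, (fun i => enum_val (cast_ord (esym def_k) i)); split=> //.
  by move=> i j /enum_val_inj/cast_ord_inj.
move=> z; split=> [Dz|[i ->]]; last exact: enum_valP.
by exists (cast_ord def_k (enum_rank_in Dz z)); rewrite cast_ordK enum_rankK_in.
Qed.

(** Elements of [G] move two columns with a common stabiliser in parallel, so that
   both orbits impose the same conditions on row permutations. *)
Lemma paired_rep_drop_dup a b (r : gT -> 'S_a.+1 * 'S_b.+1) y1 y2 :
  paired_rep G r ->
  (forall g, g \in G -> (r g).2 y1 = y1 <-> (r g).2 y2 = y2) ->
  (forall g, g \in G -> (r g).2 y1 <> y2) ->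
  exists b' (r' : gT -> 'S_a.+1 * 'S_b'.+1), (b' < b)%N /\ paired_rep G r'.
Proof.
move=> rep_r stab12 disj12; have [rM inj1 inj2 closed] := rep_r.
have agree g h : g \in G -> h \in G ->
    (r g).2 y1 = (r h).2 y1 -> (r g).2 y2 = (r h).2 y2.
  move=> Gg Gh eq1; have Ggh : (g * h^-1)%g \in G by rewrite groupM ?groupV.
  have /stab12/(congr1 (r h).2) : (r (g * h^-1)%g).2 y1 = y1.
    by rewrite rep2M ?groupV // eq1 rep2K.
  rewrite -rep2M // ?mulgKV; exact.
pose D := [set y | [forall g in G, y != (r g).2 y2]].
have DP y : y \in D <-> forall g, g \in G -> y <> (r g).2 y2.
  rewrite inE; split=> [/forall_inP Dy g Gg|Dy]; first exact/eqP/Dy.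
  by apply/forall_inP => g Gg; apply/eqP/Dy.
have Dy1 : y1 \in D.
  by apply/DP => g Gg eq1; apply: (disj12 g^-1%g); rewrite ?groupV // eq1 rep2K.
have DG y g : g \in G -> y \in D -> (r g).2 y \in D.
  move=> Gg /DP Dy; apply/DP => h Gh eq_y; apply: (Dy (h * g^-1)%g); rewrite ?groupM ?groupV //.
  by rewrite rep2M ?groupV // -eq_y rep2K.
have [b' [kappa [cardD kappa_inj kappaP]]] := set_enum Dy1.
have lt_b' : (b' < b)%N.
  suff : (#|D| < #|[set: 'I_b.+1]|)%N by rewrite cardsT card_ord cardD.
  apply: proper_card.
  rewrite properE finset.subsetT /=; apply/negP => /fintype.subsetP/(_ y2).
  rewrite finset.in_setT => /(_ isT)/DP/(_ 1%g (group1 G)).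
  by rewrite rep1 // perm1.
exists b'; suff [r' rep_r'] : exists r' : gT -> 'S_a.+1 * 'S_b'.+1, paired_rep G r'.
  by exists r'.
have Dkappa z : kappa z \in D by apply/kappaP; exists z.
apply: (paired_rep_drop_cols rep_r kappa_inj) => [g z Gg|g h Gg Gh eq_gh|s loc y].
- by apply/kappaP; apply: DG.
- have eq_D y : y \in D -> (r g).2 y = (r h).2 y.
    by case/kappaP => z ->; exact: eq_gh.
  apply: inj2 => //; apply/permP => y; have [/eq_D //|/negP nDy] := boolP (y \in D).
  have [k Gk ->] : exists2 k, k \in G & y = (r k).2 y2.
    by apply: contrapT => no_k; apply: nDy; apply/DP => k Gk eq_y; apply: no_k; exists k.
  rewrite -!rep2M //; apply: agree; rewrite ?groupM // !rep2M //.
  by apply/eq_D/DG.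
have [/kappaP[z ->]|/negP nDy] := boolP (y \in D).
  by have [z' sim_z] := loc z; exists (kappa z').
have [k Gk ->] : exists2 k, k \in G & y = (r k).2 y2.
  by apply: contrapT => no_k; apply: nDy; apply/DP => k Gk eq_y; apply: no_k; exists k.
have /kappaP[z eq_z] := DG y1 k Gk Dy1.
have [z' sim_z] := loc z.
have [h Gh eq_h] : exists2 h, h \in G & kappa z' = (r h).2 y1.
  have [g Gg [_ ->]] := sim_z ord0.
  by exists (k * g)%g; rewrite ?groupM // rep2M // eq_z.
exists ((r h).2 y2) => x; have [g Gg [eq_s eq_h']] := sim_z x.
exists g => //; split=> //; rewrite -rep2M //; apply: agree; rewrite ?groupM //.
by rewrite -eq_h rep2M // eq_z.
Qed.

End Reduction.

(** * Invariant matrices in general position *)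

Section GeneralPosition.
Variable R : realType.

Lemma avoid_seq (s : seq R) (d : R) : 0 < d -> exists e, [/\ 0 < e, e <= d & e \notin s].
Proof.
move=> d_gt0; suff [e0 [e0_gt0 le_d e0P]] :
    exists e0, [/\ 0 < e0, e0 <= d & forall e, 0 < e <= e0 -> e \notin s].
  by exists e0; rewrite e0P ?e0_gt0 /=.
elim: s => [|c s [e0 [e0_gt0 le_d e0P]]]; first by exists d.
have [c_gt0|c_le0] := ltP 0 c.
  exists (Num.min e0 (c / 2)); split.
  - by rewrite lt_min e0_gt0 divr_gt0.
  - by rewrite ge_min le_d.
  move=> e /andP[e_gt0]; rewrite le_min => /andP[le_e0 le_c].
  rewrite inE negb_or e0P ?e_gt0 // andbT; apply/eqP => eq_e.
  by move: le_c; rewrite eq_e; lra.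
exists e0; split=> // e /andP[e_gt0 le_e]; rewrite inE negb_or e0P ?e_gt0 // andbT.
by apply/eqP => eq_e; move: e_gt0; rewrite eq_e; lra.
Qed.

Lemma sum_eq_lt (I : finType) (f h : I -> R) i :
  \sum_i f i = \sum_i h i -> f i != h i -> exists j, f j < h j.
Proof.
move=> eq_sum ne_i; apply: contrapT => no_lt; case/eqP: ne_i.
have ge0 j : 0 <= f j - h j.
  by rewrite subr_ge0 leNgt; apply/negP => lt_j; apply: no_lt; exists j.
have sum0 : \sum_j (f j - h j) = 0 by rewrite sumrB eq_sum subrr.
by apply/eqP; rewrite -subr_eq0 (psumr_eq0P _ sum0).
Qed.

Lemma center_linear n m (A X : 'M[R]_(n, m)) e x y :
  center (A + e *: X) x y = center A x y + e * center X x y.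
Proof.
rewrite !mxE mulr_sumr -big_split /=; apply: eq_bigr => x' _.
rewrite mulr_sumr -big_split /=; apply: eq_bigr => y' _.
by rewrite !mxE; ring.
Qed.

Variables (gT : finGroupType) (G : {group gT}) (a b : nat).
Variable (r : gT -> 'S_a.+1 * 'S_b.+1).
Hypothesis rep_r : paired_rep G r.
Let rM : rep_morph G r. Proof. by case: rep_r. Qed.

Definition rep_invariant (A : 'M[R]_(a.+1, b.+1)) :=
  forall x y g, g \in G -> A ((r g).1 x) ((r g).2 y) = A x y.

Lemma invariant_sim A x y x' y' : rep_invariant A -> sim G r x y x' y' -> A x y = A x' y'.
Proof. by move=> invA [g Gg [-> ->]]; rewrite invA. Qed.

Lemma invariant_center A : rep_invariant A -> rep_invariant (center A).
Proof.
move=> invA x y g Gg; apply/esym.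
apply: (@center_shift _ _ _ A A (r g).1 (r g).2 (fun=> 0) (fun=> 0)).
by move=> x' y'; rewrite invA // !addr0.
Qed.

Lemma invariant_col_sum A g y : rep_invariant A -> g \in G ->
  \sum_x A x ((r g).2 y) = \sum_x A x y.
Proof.
move=> invA Gg; rewrite (reindex_perm (r g).1) /=.
by apply: eq_bigr => x _; rewrite invA.
Qed.

Lemma invariant_row_sum A g x : rep_invariant A -> g \in G ->
  \sum_y A ((r g).1 x) y = \sum_y A x y.
Proof.
move=> invA Gg; rewrite (reindex_perm (r g).2) /=.
by apply: eq_bigr => y _; rewrite invA.
Qed.

(** The product of the orbits of [x] and of [y] splits into several orbits of
   pairs. *)
Definition splits x y :=
  exists g h, [/\ g \in G, h \in G & ~ sim G r x y ((r g).1 x) ((r h).2 y)].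

Section OrbitMatrix.
Variables (x0 : 'I_a.+1) (y0 : 'I_b.+1).

Let ind x y : R := `[< sim G r x0 y0 x y >]%:R.

(** The indicator of an orbit of pairs minus its average over the surrounding
   product of orbits, up to the factor [#|G| ^ 2]: its rows and columns sum to zero,
   so that centring only scales it. *)
Definition orbit_mx : 'M[R]_(a.+1, b.+1) :=
  \matrix_(x, y) \sum_(g in G) \sum_(h in G) (ind x y - ind ((r g).1 x) ((r h).2 y)).

Let ind_inv x y g : g \in G -> ind ((r g).1 x) ((r g).2 y) = ind x y.
Proof.
move=> Gg; congr ((_ : bool)%:R); apply/asboolP/asboolP => sim0.
  by apply: (sim_trans rM sim0); apply: sim_sym => //; exact: sim_act.
by apply: (sim_trans rM sim0); exact: sim_act.
Qed.

Lemma orbit_mx_inv : rep_invariant orbit_mx.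
Proof.
move=> x y k Gk; rewrite !mxE [RHS](reindex_inj (mulgI k)) /=.
apply: eq_big => [g|g Gg]; first by rewrite groupMl.
rewrite [RHS](reindex_inj (mulgI k)) /=.
apply: eq_big => [h|h Gh]; first by rewrite groupMl.
by rewrite ind_inv // (rep1M rM) // (rep2M rM).
Qed.

Lemma orbit_mx_row_sum x : \sum_y orbit_mx x y = 0.
Proof.
under eq_bigr do rewrite mxE.
rewrite exchange_big /= big1 // => g Gg; rewrite exchange_big /= big1 // => h Gh.
apply/eqP; rewrite sumrB subr_eq0; apply/eqP.
transitivity (\sum_y ind ((r g).1 x) y); last exact: (reindex_perm (r h).2).
by rewrite [RHS](reindex_perm (r g).2); apply: eq_bigr => y _; rewrite ind_inv.
Qed.

Lemma orbit_mx_col_sum y : \sum_x orbit_mx x y = 0.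
Proof.
under eq_bigr do rewrite mxE.
rewrite exchange_big /= big1 // => g Gg; rewrite exchange_big /= big1 // => h Gh.
apply/eqP; rewrite sumrB subr_eq0; apply/eqP.
transitivity (\sum_x ind x ((r h).2 y)); last exact: (reindex_perm (r g).1).
by rewrite [RHS](reindex_perm (r h).1); apply: eq_bigr => x _; rewrite ind_inv.
Qed.

Lemma center_orbit_mx x y : center orbit_mx x y = (a.+1 * b.+1)%:R * orbit_mx x y.
Proof.
rewrite centerE orbit_mx_row_sum orbit_mx_col_sum !mulr0 !subr0 big1 ?addr0 // => x' _.
exact: orbit_mx_row_sum.
Qed.

Lemma orbit_mx_separates x y : splits x0 y0 -> ~ sim G r x0 y0 x y ->
  center orbit_mx x0 y0 != center orbit_mx x y.
Proof.
case=> g [h [Gg Gh nsim]] nsim'; rewrite !center_orbit_mx.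
rewrite (inj_eq (mulfI _)) ?pnatr_eq0 //; apply/eqP => eq_mx.
have ind0 : ind x0 y0 = 1 by rewrite /ind asboolT //; exact: sim_refl.
have ind_ge0 x' y' : 0 <= ind x' y' by rewrite /ind ler0n.
have ind_le1 x' y' : ind x' y' <= 1 by rewrite /ind lern1 leq_b1.
have : 0 < orbit_mx x0 y0.
  rewrite mxE ind0 (bigD1 g) //= (bigD1 h) //= {1}/ind asboolF // subr0 -addrA.
  apply: ltr_wpDr => //; apply: addr_ge0.
    by apply: sumr_ge0 => h' _; rewrite subr_ge0.
  by apply: sumr_ge0 => g' _; apply: sumr_ge0 => h' _; rewrite subr_ge0.
rewrite eq_mx mxE {1}/ind asboolF // => /lt_geF/negP; apply.
by apply: sumr_le0 => g' _; apply: sumr_le0 => h' _; rewrite sub0r oppr_le0.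
Qed.

End OrbitMatrix.

Definition separating (A : 'M[R]_(a.+1, b.+1)) :=
  forall x y x' y', splits x y -> ~ sim G r x y x' y' -> center A x y != center A x' y'.

(** Each required inequality fails on a hyperplane of invariant matrices, so a
   small multiple of an orbit matrix repairs one of them without spoiling those
   already satisfied. *)
Lemma separating_perturbation A0 (d : R) : rep_invariant A0 -> 0 < d ->
  exists A, [/\ rep_invariant A, separating A & forall x y, `|A x y - A0 x y| <= d].
Proof.
move=> inv0 d_gt0.
pose quad : finType := ('I_a.+1 * 'I_b.+1 * ('I_a.+1 * 'I_b.+1))%type.
pose diff (A : 'M[R]_(a.+1, b.+1)) (q : quad) :=
  center A q.1.1 q.1.2 - center A q.2.1 q.2.2.
pose good (q : quad) := splits q.1.1 q.1.2 /\ ~ sim G r q.1.1 q.1.2 q.2.1 q.2.2.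
suff [A [invA sepA leA]] : exists A, [/\ rep_invariant A,
    forall q : quad, q \in enum {: quad} -> good q -> diff A q != 0 &
    forall x y, `|A x y - A0 x y| <= d].
  exists A; split=> // x y x' y' split_xy nsim.
  by have := sepA (x, y, (x', y')); rewrite mem_enum /diff subr_eq0; apply.
elim: (enum _) d d_gt0 => [|q s IH] d d_gt0.
  by exists A0; split=> // x y; rewrite subrr normr0 ltW.
have [|A [invA sepA leA]] := IH (d / 2); first by rewrite divr_gt0.
have [good_q|bad_q] := pselect (good q); last first.
  exists A; split=> // [q'|x y]; last by apply: le_trans (leA x y) _; lra.
  by rewrite inE => /predU1P[->|/sepA].
have [X invX sepX] : exists2 X, rep_invariant X & diff X q != 0.
  exists (orbit_mx q.1.1 q.1.2); first exact: orbit_mx_inv.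
  by case: good_q => sp nsim; rewrite /diff subr_eq0; exact: orbit_mx_separates.
pose M := 1 + \sum_x \sum_y `|X x y|.
have M_gt0 : 0 < M by rewrite ltr_pwDl // sumr_ge0 // => x _; rewrite sumr_ge0.
have X_le x y : `|X x y| <= M.
  rewrite /M (bigD1 x) //= (bigD1 y) //= addrCA -!addrA lerDl.
  by rewrite !addr_ge0 // !sumr_ge0 // => x' _; rewrite sumr_ge0.
have [e [e_gt0 le_e eP]] :
    exists e, [/\ 0 < e, e <= d / 2 / M &
      e \notin [seq - diff A q' / diff X q' | q' <- q :: s]].
  by apply: avoid_seq; rewrite !divr_gt0.
have diffE q' : diff (A + e *: X) q' = diff A q' + e * diff X q'.
  by rewrite /diff !center_linear; ring.
exists (A + e *: X); split=> [x y g Gg|q' q's good_q'|x y].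
- by rewrite !mxE invA // invX.
- rewrite diffE; have [X0|X0] := eqVneq (diff X q') 0; last first.
    apply/eqP => eq0; case/negP: eP; apply/mapP; exists q' => //.
    by apply: (mulIf X0); rewrite divfK //; lra.
  rewrite X0 mulr0 addr0; move: q's; rewrite inE => /predU1P[eq_q|/sepA]; last exact.
  by move: sepX; rewrite -eq_q X0 eqxx.
rewrite !mxE addrAC; apply: le_trans (ler_normD _ _) _.
have : `|e * X x y| <= d / 2.
  rewrite normrM gtr0_norm //; apply: le_trans (ler_wpM2l (ltW e_gt0) (X_le x y)) _.
  by rewrite -ler_pdivlMr.
by have := leA x y; lra.
Qed.

End GeneralPosition.

(** * An irredundant matrix with prescribed automorphisms *)

Section Canon.
Variables (T : finType) (e : T -> T -> Prop).
Hypotheses (e_refl : forall x, e x x) (e_sym : forall x y, e x y -> e y x).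
Hypothesis e_trans : forall x y z, e x y -> e y z -> e x z.

Definition canon x := odflt x [pick y | `[< e x y >]].

Lemma canonP x : e x (canon x).
Proof. by rewrite /canon; case: pickP => [y /asboolP //|_]; exact: e_refl. Qed.

Lemma canon_eq x y : e x y <-> canon x = canon y.
Proof.
split=> [xy|eq_c]; last first.
  by apply: e_trans (canonP x) _; rewrite eq_c; exact/e_sym/canonP.
rewrite /canon -(@eq_pick _ (fun z => `[< e x z >])) => [|z].
  by case: pickP => // /(_ x); rewrite asboolT.
by apply/asboolP/asboolP; [apply: e_trans; exact: e_sym | exact: e_trans].
Qed.

End Canon.

Lemma surj_of_card (T U : finType) (A : {set T}) (B : {set U}) x0 :
  x0 \in A -> (#|A| <= #|B|)%N ->
  exists h : U -> T, (forall y, h y \in A) /\ forall x, x \in A -> exists2 y, y \in B & h y = x.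
Proof.
move=> Ax0 le_AB; exists (fun y => nth x0 (enum A) (index y (enum B))); split=> [y|x Ax].
  have [lt_y|le_y] := ltnP (index y (enum B)) (size (enum A)).
    by rewrite -mem_enum mem_nth.
  by rewrite nth_default.
have lt_x : (index x (enum A) < size (enum B))%N.
  by rewrite -cardE (leq_trans _ le_AB) // [X in (_ < X)%N]cardE index_mem mem_enum.
have y0 : U by case: (enum B) lt_x.
exists (nth y0 (enum B) (index x (enum A))); first by rewrite -mem_enum mem_nth.
by rewrite index_uniq ?enum_uniq // nth_index // mem_enum.
Qed.

Section Orbits.
Variables (gT : finGroupType) (G : {group gT}) (a b : nat).

Definition row_sim (r : gT -> 'S_a * 'S_b) x x' := exists2 g, g \in G & x' = (r g).1 x.
Definition col_sim (r : gT -> 'S_a * 'S_b) y y' := exists2 g, g \in G & y' = (r g).2 y.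

Definition row_reps r := [set canon (row_sim r) x | x in 'I_a].
Definition col_reps r := [set canon (col_sim r) y | y in 'I_b].

Variable r : gT -> 'S_a * 'S_b.
Hypothesis rM : rep_morph G r.

Lemma col_sim_refl y : col_sim r y y.
Proof. by exists 1%g; rewrite ?group1 // (rep1 rM) perm1. Qed.

Lemma col_sim_sym y y' : col_sim r y y' -> col_sim r y' y.
Proof. by case=> g Gg ->; exists g^-1%g; rewrite ?groupV // (rep2K rM). Qed.

Lemma col_sim_trans y y' y'' : col_sim r y y' -> col_sim r y' y'' -> col_sim r y y''.
Proof.
by case=> g Gg -> [h Gh ->]; exists (g * h)%g; rewrite ?groupM // (rep2M rM).
Qed.

Lemma row_sim_refl x : row_sim r x x.
Proof. by exists 1%g; rewrite ?group1 // (rep1 rM) perm1. Qed.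

Lemma row_sim_sym x x' : row_sim r x x' -> row_sim r x' x.
Proof. by case=> g Gg ->; exists g^-1%g; rewrite ?groupV // (rep1K rM). Qed.

Lemma col_canonP y : col_sim r y (canon (col_sim r) y).
Proof. exact: canonP col_sim_refl y. Qed.

Lemma col_canon_eq y y' : col_sim r y y' <-> canon (col_sim r) y = canon (col_sim r) y'.
Proof. exact: (canon_eq col_sim_refl col_sim_sym col_sim_trans). Qed.

(** When there are no more row orbits than column orbits, row orbits can be
   assigned to column orbits surjectively; picking an orbit of pairs in each
   product so obtained meets every row and every column. *)
Lemma exists_peaks : (#|row_reps r| <= #|col_reps r|)%N ->
  exists T : 'I_a -> 'I_b -> Prop,
    [/\ forall x y g, g \in G -> T ((r g).1 x) ((r g).2 y) <-> T x y,
        forall x y x' y', T x y -> T x' y' -> col_sim r y y' -> sim G r x y x' y',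
        (0 < a)%N -> forall y, exists x, T x y
      & forall x, exists y, T x y].
Proof.
move=> le_reps; pose c := canon (col_sim r).
case: (pickP 'I_a) => [x0 _|no_x]; last first.
  exists (fun _ _ => True); split=> //.
  - by move=> x; have := no_x x.
  - by move=> a_gt0; have := no_x (Ordinal a_gt0).
  - by move=> x; have := no_x x.
have Ax0 : canon (row_sim r) x0 \in row_reps r by exact: imset_f.
have [h [hA h_surj]] := surj_of_card Ax0 le_reps.
exists (fun x y => sim G r (h (c y)) (c y) x y); split.
- move=> x y g Gg; have <- : c y = c ((r g).2 y) by apply/col_canon_eq; exists g.
  split=> simxy; apply: (sim_trans rM simxy); first by apply: sim_sym => //; exact: sim_act.
  exact: sim_act.
- move=> x y x' y' simxy simxy' /col_canon_eq eq_c; move: simxy'; rewrite /c -eq_c.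
  by apply: sim_trans => //; exact: sim_sym.
- move=> _ y; have /col_sim_sym[g Gg eq_y] := col_canonP y.
  by exists ((r g).1 (h (c y))); exists g.
move=> x; have /h_surj[y' /imsetP[y _ ->] eq_h] : canon (row_sim r) x \in row_reps r.
  exact: imset_f.
have /row_sim_sym[g Gg eq_x] := canonP row_sim_refl x.
have eq_c : c ((r g).2 (c y)) = c y.
  apply/esym/col_canon_eq; apply: (col_sim_trans (col_canonP y)).
  by exists g.
by exists ((r g).2 (c y)); rewrite eq_c eq_h; exists g.
Qed.

End Orbits.

Section Construction.
Variable R : realType.
Variables (gT : finGroupType) (G : {group gT}) (a b : nat).
Variable (r : gT -> 'S_a.+1 * 'S_b.+1).
Hypothesis rep_r : paired_rep G r.
Hypothesis no_fixed_row : forall x, exists2 g, g \in G & (r g).1 x != x.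
Hypothesis no_fixed_col : forall y, exists2 g, g \in G & (r g).2 y != y.
Hypothesis no_dup : forall y1 y2,
  (forall g, g \in G -> (r g).2 y1 = y1 <-> (r g).2 y2 = y2) -> col_sim G r y1 y2.
Variable T : 'I_a.+1 -> 'I_b.+1 -> Prop.
Hypothesis T_inv : forall x y g, g \in G -> T ((r g).1 x) ((r g).2 y) <-> T x y.
Hypothesis T_sim : forall x y x' y', T x y -> T x' y' -> col_sim G r y y' -> sim G r x y x' y'.
Hypothesis T_col : forall y, exists x, T x y.
Hypothesis T_row : forall x, exists y, T x y.

Let rM : rep_morph G r. Proof. by case: rep_r. Qed.

Lemma sim_row_sim x y x' y' : sim G r x y x' y' -> row_sim G r x x'.
Proof. by case=> g Gg [-> _]; exists g. Qed.

Lemma sim_col_sim x y x' y' : sim G r x y x' y' -> col_sim G r y y'.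
Proof. by case=> g Gg [_ ->]; exists g. Qed.

Lemma cols_differ y y' : y != y' -> exists x, ~ sim G r x y x y'.
Proof.
move=> ne_y; apply: contrapT => /forallNP all_sim; case/eqP: ne_y.
by apply: (distinct_cols rep_r) => x; apply: contrapT; exact: all_sim.
Qed.

Lemma rows_differ x x' : x != x' -> exists y, ~ sim G r x y x' y.
Proof.
move=> ne_x; apply: contrapT => /forallNP all_sim; case/eqP: ne_x.
by apply: (distinct_rows rep_r) => y; apply: contrapT; exact: all_sim.
Qed.

Lemma T_col_proper y : exists x, ~ T x y.
Proof.
have [g Gg ne_y] := no_fixed_col y; rewrite eq_sym in ne_y.
have [x nsim] := cols_differ ne_y.
have [Txy|] := pselect (T x y); last by exists x.
exists ((r g^-1%g).1 x) => Tx; apply: nsim; apply: T_sim => //; last by exists g.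
by move: Tx; rewrite -(T_inv _ _ Gg) -(rep1M rM) ?groupV // mulVg (rep1 rM) perm1.
Qed.

Lemma T_row_proper x : exists y, ~ T x y.
Proof.
apply: contrapT => /forallNP Tx.
have {}Tx y : T x y by apply: contrapT; exact: Tx.
have [g Gg ne_y] := no_fixed_col ord0; rewrite eq_sym in ne_y.
have [x0 nsim] := cols_differ ne_y.
have [y0 Tx0] := T_row x0.
have [k Gk [eq_x0 _]] := T_sim (Tx y0) Tx0 (col_sim_refl rM y0).
have Tx' y : T x0 y.
  rewrite eq_x0 -[y](rep2K rM _ (groupVr Gk)) invgK; exact/T_inv.
by apply: nsim; apply: T_sim => //; exists g.
Qed.

Definition height y := #|[set x | `[< T x y >]]|.

Lemma height_inv y g : g \in G -> height ((r g).2 y) = height y.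
Proof.
move=> Gg; rewrite /height -[RHS](card_imset _ (@perm_inj _ (r g).1)).
apply: eq_card => x; rewrite inE; apply/asboolP/imsetP => [Tx|[x' + ->]].
  exists ((r g^-1%g).1 x); last by rewrite -(rep1M rM) ?groupV // mulVg (rep1 rM) perm1.
  rewrite inE; apply/asboolP; rewrite -(T_inv _ _ Gg).
  by rewrite -(rep1M rM) ?groupV // mulVg (rep1 rM) perm1.
by rewrite inE => /asboolP; rewrite T_inv.
Qed.

Lemma height_gt0 y : (0 < height y)%N.
Proof.
by have [x Tx] := T_col y; apply/card_gt0P; exists x; rewrite inE; apply/asboolP.
Qed.

(** The orbit outside [T] selected in each column will carry the lowest entries,
   which prevents a column from dominating another with the same peaks. *)
Lemma exists_low : exists low : 'I_a.+1 -> 'I_b.+1 -> Prop,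
  [/\ forall x y g, g \in G -> low ((r g).1 x) ((r g).2 y) <-> low x y,
      forall x y x' y', low x y -> low x' y' -> col_sim G r y y' -> sim G r x y x' y',
      forall y, exists x, low x y
    & forall x y, low x y -> ~ T x y].
Proof.
have [l lP] := choice T_col_proper; pose c := canon (col_sim G r).
exists (fun x y => sim G r (l (c y)) (c y) x y); split.
- move=> x y g Gg; have <- : c y = c ((r g).2 y) by apply/(col_canon_eq rM); exists g.
  split=> simxy; apply: (sim_trans rM simxy); first by apply: sim_sym => //; exact: sim_act.
  exact: sim_act.
- move=> x y x' y' simxy simxy' /(col_canon_eq rM) eq_c; move: simxy'; rewrite /c -eq_c.
  by apply: sim_trans => //; exact: sim_sym.
- move=> y; have /(col_sim_sym rM)[g Gg eq_y] := col_canonP rM y.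
  by exists ((r g).1 (l (c y))); exists g.
by move=> x y [g Gg [-> eq_y]]; rewrite [X in T _ X]eq_y => /(T_inv _ _ Gg); exact: lP.
Qed.

Section Profile.
Variable low : 'I_a.+1 -> 'I_b.+1 -> Prop.
Hypothesis low_inv : forall x y g, g \in G -> low ((r g).1 x) ((r g).2 y) <-> low x y.
Hypothesis low_sim :
  forall x y x' y', low x y -> low x' y' -> col_sim G r y y' -> sim G r x y x' y'.
Hypothesis low_col : forall y, exists x, low x y.
Hypothesis low_notT : forall x y, low x y -> ~ T x y.

Definition two_valued y := forall x, ~ T x y -> low x y.

Lemma two_valued_inv y g : g \in G -> two_valued ((r g).2 y) <-> two_valued y.
Proof.
move=> Gg; split=> two x nT.
  by apply/(low_inv _ _ Gg)/two => /(T_inv _ _ Gg).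
have eq_x : x = (r g).1 ((r g^-1%g).1 x).
  by rewrite -(rep1M rM) ?groupV // mulVg (rep1 rM) perm1.
by rewrite eq_x; apply/low_inv/two => //; rewrite -(T_inv _ _ Gg) -eq_x.
Qed.

Definition spread y : R :=
  if `[< two_valued y >] then 0 else (canon (col_sim G r) y).+1%:R.

Lemma spread_inv y g : g \in G -> spread ((r g).2 y) = spread y.
Proof.
move=> Gg; rewrite /spread (_ : `[< _ >] = `[< two_valued y >]); last first.
  by apply/asboolP/asboolP => /(two_valued_inv _ Gg).
have /(col_canon_eq rM)-> // : col_sim G r ((r g).2 y) y.
by apply: (col_sim_sym rM); exists g.
Qed.

Lemma spread_ge0 y : 0 <= spread y.
Proof. by rewrite /spread; case: ifP. Qed.

Lemma spread_le y : spread y <= b.+1%:R.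
Proof. by rewrite /spread; case: ifP => // _; rewrite ler_nat ltn_ord. Qed.

(** Heights grow with the number of peaks: a column whose peaks strictly include
   those of another must drop further than the other one does. The spreads deal
   with columns that have the same peaks. The factor [4 * (b + 2)] exceeds four times
   the absolute value of any entry outside the peaks. *)
Definition profile : 'M[R]_(a.+1, b.+1) := \matrix_(x, y)
  if `[< T x y >] then (4 * b.+2)%:R * (height y)%:R
  else if `[< low x y >] then - spread y else spread y.

Lemma profile_inv : rep_invariant G r profile.
Proof.
move=> x y g Gg; rewrite !mxE height_inv // spread_inv //.
rewrite (_ : `[< T ((r g).1 x) _ >] = `[< T x y >]); last first.
  by apply/asboolP/asboolP => /(T_inv _ _ Gg).
rewrite (_ : `[< low ((r g).1 x) _ >] = `[< low x y >]) //.
by apply/asboolP/asboolP => /(low_inv _ _ Gg).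
Qed.

Lemma profile_T x y : T x y -> profile x y = (4 * b.+2)%:R * (height y)%:R.
Proof. by move=> Txy; rewrite mxE asboolT. Qed.

Lemma profile_notT x y : ~ T x y -> - b.+1%:R <= profile x y <= b.+1%:R.
Proof.
move=> nT; rewrite mxE asboolF //.
by have := spread_ge0 y; have := spread_le y; case: ifP => _; lra.
Qed.

(** Two column orbits with the same peaks and a single orbit elsewhere have the
   same stabilisers, which is excluded; otherwise the wider oscillation exceeds
   the other one in both directions. *)
Lemma profile_incomparable y y' : ~ col_sim G r y y' -> (forall x, T x y <-> T x y') ->
  exists2 x, ~ T x y & profile x y + 1 <= profile x y'.
Proof.
move=> nsim eqT.
have wide z z' : spread z < spread z' -> spread z + 1 <= spread z'.
  rewrite /spread; case: ifP => _; case: ifP => _; rewrite ?ltxx //.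
  - by rewrite add0r ler1n.
  - by rewrite ltNge ler0n.
  - by rewrite ltr_nat natr1 ler_nat.
have not_two z z' : spread z < spread z' -> ~ two_valued z'.
  by move=> lt_z two; move: lt_z; rewrite [X in _ < X]/spread asboolT // ltNge spread_ge0.
have [lt_y|lt_y'|eq_s] := ltgtP (spread y) (spread y').
- have [x nTx nlow] : exists2 x, ~ T x y' & ~ low x y'.
    apply: contrapT => no_x; apply: (not_two _ _ lt_y) => x nT.
    by apply: contrapT => nlow; apply: no_x; exists x.
  have nTxy : ~ T x y by rewrite eqT.
  have eq_high : profile x y' = spread y' by rewrite mxE !asboolF.
  exists x; rewrite // eq_high mxE asboolF //.
  by have := wide _ _ lt_y; have := spread_ge0 y; case: ifP => _; lra.
- have [x lowx] := low_col y; have nTx := low_notT lowx.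
  have nTx' : ~ T x y' by rewrite -eqT.
  have eq_low : profile x y = - spread y by rewrite mxE asboolF // asboolT.
  exists x; rewrite // eq_low mxE asboolF //.
  by have := wide _ _ lt_y'; have := spread_ge0 y'; case: ifP => _; lra.
have [two two'] : two_valued y /\ two_valued y'.
  move: eq_s; rewrite /spread; case: asboolP => [two|_]; case: asboolP => [two'|_] //.
  - by move/eqP; rewrite eq_sym pnatr_eq0.
  - by move/eqP; rewrite pnatr_eq0.
  by move/eqP; rewrite eqr_nat eqSS => /eqP/val_inj/(col_canon_eq rM)/nsim.
case: nsim; apply: no_dup.
have stab z z' : two_valued z' -> (forall x, T x z <-> T x z') ->
    forall g, g \in G -> (r g).2 z = z -> (r g).2 z' = z'.
  move=> two_z' eqTz g Gg fix_z; apply/esym/(distinct_cols rep_r) => x.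
  have sim_z' : col_sim G r z' ((r g).2 z') by exists g.
  have eqTg : T x ((r g).2 z') <-> T x z'.
    have eq_x : x = (r g).1 ((r g^-1%g).1 x).
      by rewrite -(rep1M rM) ?groupV // mulVg (rep1 rM) perm1.
    by rewrite [X in T X ((r g).2 z')]eq_x (T_inv _ _ Gg) -!eqTz -(T_inv _ z Gg) -eq_x fix_z.
  have [Tx|nTx] := pselect (T x z'); first by apply: T_sim => //; rewrite eqTg.
  have /(_ x) two_gz' : two_valued ((r g).2 z') by apply/(two_valued_inv _ Gg).
  by apply: low_sim sim_z'; [exact: two_z' | apply: two_gz'; rewrite eqTg].
by move=> g Gg; split; apply: stab => // x; rewrite eqT.
Qed.

Section Irredundant.
Variable A : 'M[R]_(a.+1, b.+1).
Hypotheses (A_inv : rep_invariant G r A) (A_sep : separating G r A).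
Hypothesis A_near : forall x y, `|A x y - profile x y| <= 8%:R^-1.

Lemma splits_differ x y x' : splits G r x y -> ~ sim G r x y x' y -> row_sim G r x x' ->
  A x y != A x' y.
Proof.
move=> sp nsim [g Gg eq_x]; apply: contraNneq (A_sep sp nsim) => eqA.
have eq_sum : \sum_z A x' z = \sum_z A x z by rewrite eq_x (invariant_row_sum _ A_inv Gg).
by rewrite !centerE eqA eq_sum.
Qed.

Lemma splits_differ_col x y y' : splits G r x y -> ~ sim G r x y x y' -> col_sim G r y y' ->
  A x y != A x y'.
Proof.
move=> sp nsim [g Gg eq_y]; apply: contraNneq (A_sep sp nsim) => eqA.
have eq_sum : \sum_z A z y' = \sum_z A z y by rewrite eq_y (invariant_col_sum _ A_inv Gg).
by rewrite !centerE eqA eq_sum.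
Qed.

Lemma profile_bounds x y : profile x y - 8%:R^-1 <= A x y <= profile x y + 8%:R^-1.
Proof. by have := A_near x y; rewrite ler_norml; lra. Qed.

Lemma profile_peak x y : T x y -> (4 * b.+2)%:R <= profile x y.
Proof. by move=> Txy; rewrite profile_T // ler_peMr // ler1n height_gt0. Qed.

Lemma slope_bound : 4 * (b.+1%:R : R) + 4 <= (4 * b.+2)%:R.
Proof. by rewrite natrM -[b.+2%:R]natr1; lra. Qed.

Lemma b_ge0 : 0 <= b.+1%:R :> R. Proof. exact: ler0n. Qed.

(** A row is irreducible at any of its peaks: away from the peaks of the column
   the peak itself is too high, and rows of its orbit, having equal sums, cannot
   lie entirely below it. *)
Lemma construction_irr_rows : irr_rows A.
Proof.
move=> x; have [y Txy] := T_row x; exists y => x' ne_x sup.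
have [Tx'y|nTx'y] := pselect (T x' y); last first.
  have [y' nTxy'] := T_row_proper x.
  have := sup y'; have := profile_bounds x y; have := profile_bounds x' y'.
  have := profile_bounds x y'; have := profile_bounds x' y.
  have := profile_notT nTx'y; have := profile_notT nTxy'; have := profile_peak Txy.
  have low' : - b.+1%:R <= profile x' y'.
    have [/profile_peak|/profile_notT/andP[]//] := pselect (T x' y').
    by have := slope_bound; have := b_ge0; lra.
  by have := slope_bound; have := b_ge0; lra.
have simx := T_sim Txy Tx'y (col_sim_refl rM y).
rewrite eq_sym in ne_x; have [z nsim] := rows_differ ne_x.
have [g Gg eq_x] := sim_row_sim simx.
have eq_sum : \sum_z A x z = \sum_z A x' z by rewrite eq_x (invariant_row_sum _ A_inv Gg).
have sp : splits G r x z.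
  by exists g, 1%g; rewrite group1 (rep1 rM) perm1 -eq_x.
have [y' lt_y'] := sum_eq_lt eq_sum (splits_differ sp nsim (sim_row_sim simx)).
by have := sup y'; rewrite (invariant_sim A_inv simx); lra.
Qed.

(** A column is irreducible at any of its peaks. Against a column of another orbit
   with a peak in the same row, a drop has to be found: at a peak of the other
   column alone, or outside all peaks when the peaks coincide, or because the
   heights differ when the peaks of the other column are strictly fewer. *)
Lemma construction_irr_cols : irr_rows A^T.
Proof.
move=> y; have [x Txy] := T_col y; exists x => y' ne_y sup.
have {}sup x' : A x y + A x' y' <= A x' y + A x y' by have := sup x'; rewrite !mxE.
rewrite eq_sym in ne_y.
have low' x' : - b.+1%:R <= profile x' y'.
  have [/profile_peak|/profile_notT/andP[]//] := pselect (T x' y').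
  by have := slope_bound; have := b_ge0; lra.
have [Txy'|nTxy'] := pselect (T x y'); last first.
  have [x' nTx'y] := T_col_proper y.
  have := sup x'; have := profile_bounds x y; have := profile_bounds x' y'.
  have := profile_bounds x y'; have := profile_bounds x' y.
  have := profile_notT nTx'y; have := profile_notT nTxy'; have := profile_peak Txy.
  by have := low' x'; have := slope_bound; have := b_ge0; lra.
have [simy|nsimy] := pselect (col_sim G r y y').
  have simxy := T_sim Txy Txy' simy.
  have [z nsim] := cols_differ ne_y.
  have [g Gg eq_y] := simy.
  have eq_sum : \sum_z A z y = \sum_z A z y' by rewrite eq_y (invariant_col_sum _ A_inv Gg).
  have sp : splits G r z y.
    by exists 1%g, g; rewrite group1 (rep1 rM) perm1 -eq_y.
  have [x' lt_x'] := sum_eq_lt eq_sum (splits_differ_col sp nsim simy).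
  by have := sup x'; rewrite (invariant_sim A_inv simxy); lra.
have [[x' Tx' nTx']|sub] := pselect (exists2 x', T x' y' & ~ T x' y).
  have := sup x'; have := profile_bounds x y; have := profile_bounds x' y'.
  have := profile_bounds x y'; have := profile_bounds x' y.
  have := profile_notT nTx'; have := profile_peak Txy.
  rewrite (profile_T Tx') (profile_T Txy').
  by have := slope_bound; have := b_ge0; lra.
have {}sub x' : T x' y' -> T x' y.
  by move=> Tx'; apply: contrapT => nTx'; apply: sub; exists x'.
have [eqT|neT] := pselect (forall x', T x' y <-> T x' y').
  have [x' nTx' lt_x'] := profile_incomparable nsimy eqT.
  have eq_h : height y = height y'.
    by apply: eq_card => z; rewrite !inE; apply/asboolP/asboolP => /eqT.
  have := sup x'; have := profile_bounds x y; have := profile_bounds x' y'.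
  have := profile_bounds x y'; have := profile_bounds x' y.
  by rewrite (profile_T Txy) (profile_T Txy') eq_h; lra.
have [x1 Tx1 nTx1] : exists2 x1, T x1 y & ~ T x1 y'.
  apply: contrapT => no_x1; apply: neT => z; split=> [Tz|]; last exact: sub.
  by apply: contrapT => nTz; apply: no_x1; exists z.
have lt_h : (height y' < height y)%N.
  apply: proper_card; apply/properP; split.
    by apply/fintype.subsetP => z; rewrite !finset.in_set => /asboolP/sub Tz; apply/asboolP.
  by exists x1; rewrite finset.in_set; [exact/asboolP | exact/asboolP].
have lt_peaks : (4 * b.+2)%:R * (height y')%:R + (4 * b.+2)%:R <=
                (4 * b.+2)%:R * (height y)%:R :> R.
  by rewrite -!natrM -natrD ler_nat -mulnSr leq_mul2l lt_h orbT.
have [x' nTx'y] := T_col_proper y.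
have := sup x'; have := profile_bounds x y; have := profile_bounds x' y'.
have := profile_bounds x y'; have := profile_bounds x' y.
have := profile_notT nTx'y; have := low' x'.
rewrite (profile_T Txy) (profile_T Txy').
by have := slope_bound; have := b_ge0; lra.
Qed.

(** An automorphism of the centred matrix maps each pair lying in a product of
   orbits that splits into its own orbit of pairs; such pairs exist in every row
   and column, so all orbits of pairs are preserved. *)
Lemma construction_realizes : realizes G A r.
Proof.
have [_ inj1 inj2 closed] := rep_r.
split; [exact: construction_irr_rows|exact: construction_irr_cols|exact: rM| |].
  by move=> g h Gg Gh eq_gh; apply: inj1; rewrite //= eq_gh.
move=> u; split=> [aut|[g Gg ->] x y]; last exact: (invariant_center A_inv).
apply: closed => x y.
have split_sim x1 y1 : splits G r x1 y1 -> sim G r x1 y1 (u.1 x1) (u.2 y1).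
  move=> sp; apply: contrapT => nsim.
  by have := A_sep sp nsim; rewrite aut eqxx.
have [/split_sim[g Gg [e1 e2]]|nsp] := pselect (splits G r x y); first by exists g.
have [g Gg eq_x] : row_sim G r x (u.1 x).
  have [g Gg ne_x] := no_fixed_row x; rewrite eq_sym in ne_x.
  have [z nsim] := rows_differ ne_x.
  apply: (@sim_row_sim _ z _ (u.2 z)); apply: split_sim.
  by exists g, 1%g; rewrite group1 (rep1 rM) perm1.
have [h Gh eq_y] : col_sim G r y (u.2 y).
  have [h Gh ne_y] := no_fixed_col y; rewrite eq_sym in ne_y.
  have [z nsim] := cols_differ ne_y.
  apply: (@sim_col_sim z _ (u.1 z)); apply: split_sim.
  by exists 1%g, h; rewrite group1 (rep1 rM) perm1.
have [k Gk [e1 e2]] : sim G r x y (u.1 x) (u.2 y).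
  by apply: contrapT => nsim; apply: nsp; exists g, h; rewrite -eq_x -eq_y.
by exists k.
Qed.

End Irredundant.

End Profile.
End Construction.

(** * From paired 2-closed groups to H-classes *)

Section GroupToHClass.
Variable R : realType.
Variables (gT : finGroupType) (G : {group gT}).

Definition realizable a b := exists p q (A : 'M[R]_(p.+1, q.+1)) rho,
  [/\ (p <= a)%N, (q <= b)%N & realizes G A rho].

Lemma realizable_swap a b : realizable a b -> realizable b a.
Proof.
case=> p [q [A [rho [le_p le_q [irr_r irr_c rhoM rho_inj autP]]]]].
exists q, p, A^T, (swap_rep rho); split=> //; split; rewrite ?trmxK //.
- by move=> g h Gg Gh; rewrite /swap_rep rhoM.
- move=> g h Gg Gh [eq2 eq1]; apply: rho_inj => //.
  by rewrite [LHS]surjective_pairing [RHS]surjective_pairing eq1 eq2.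
case=> u2 u1; split=> [aut|[g Gg [-> ->]] y x].
  have /autP[g Gg eq_g] : forall x y, center A ((u1, u2).1 x) ((u1, u2).2 y) = center A x y.
    by move=> x y; have := aut y x; rewrite center_tr [LHS]mxE [RHS]mxE.
  by exists g; rewrite // /swap_rep -eq_g.
rewrite center_tr [LHS]mxE [RHS]mxE; have [_] := autP (rho g); apply.
by exists g.
Qed.

Lemma realizable_le a b a' b' : (a <= a')%N -> (b <= b')%N -> realizable a b -> realizable a' b'.
Proof.
move=> le_a le_b [p [q [A [rho [le_p le_q realA]]]]].
by exists p, q, A, rho; split=> //; [exact: leq_trans le_a | exact: leq_trans le_b].
Qed.

Lemma realizable_trivial a b : (forall g, g \in G -> g = 1%g) -> realizable a b.
Proof.
move=> triv; have eq_perm (s t : 'S_1) : s = t by apply/permP => i; rewrite [LHS]ord1 [RHS]ord1.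
exists 0, 0, 0, (fun=> 1%g); split=> //; split.
- by move=> x; exists ord0 => x'; rewrite !ord1.
- by move=> x; exists ord0 => x'; rewrite !ord1.
- by move=> g h _ _; rewrite mulg1.
- by move=> g h /triv -> /triv ->.
case=> s t; split=> [_|_ x y]; last by rewrite !ord1.
exists 1%g; rewrite ?group1 //; congr (_, _); exact: eq_perm.
Qed.

Lemma construction a b (r : gT -> 'S_a.+1 * 'S_b.+1) :
  paired_rep G r ->
  (forall x, exists2 g, g \in G & (r g).1 x != x) ->
  (forall y, exists2 g, g \in G & (r g).2 y != y) ->
  (forall y1 y2, (forall g, g \in G -> (r g).2 y1 = y1 <-> (r g).2 y2 = y2) ->
     col_sim G r y1 y2) ->
  (#|row_reps G r| <= #|col_reps G r|)%N ->
  exists A : 'M[R]_(a.+1, b.+1), realizes G A r.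
Proof.
move=> rep_r fix_row fix_col no_dup le_reps; have [rM _ _ _] := rep_r.
have [T [T_inv T_sim T_col T_row]] := exists_peaks rM le_reps.
have {}T_col := T_col (ltn0Sn a).
have [low [low_inv low_sim low_col low_notT]] :=
  exists_low rep_r fix_col T_inv T_sim.
have inv0 := @profile_inv R _ _ _ _ _ rep_r _ T_inv _ low_inv.
(* Apart from those drawn from equal sums over an orbit, the inequalities behind
   irredundancy compare sums of two entries with a margin of at least 1, which four
   errors of 1/8 do not exhaust. *)
have [|A [A_inv A_sep A_near]] := separating_perturbation rep_r inv0 (d := 8%:R^-1).
  by rewrite invr_gt0 ltr0n.
by exists A; apply: (construction_realizes rep_r fix_row fix_col no_dup T_inv T_sim
  T_col T_row low_inv low_sim low_col low_notT).
Qed.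

(** Representations with a fixed point or with two isomorphic orbits on the same
   side are replaced by smaller ones, until the construction applies up to
   exchanging the two sides. *)
Lemma paired_rep_realizable a b (r : gT -> 'S_a.+1 * 'S_b.+1) :
  paired_rep G r -> realizable a b.
Proof.
have [k] := ubnP (a + b); elim: k a b r => // k IH a b r lt_k rep_r.
have [triv|nontriv] := pselect (forall g, g \in G -> g = 1%g).
  exact: realizable_trivial.
have dropP a' b' (r' : gT -> 'S_a'.+1 * 'S_b'.+1) :
    paired_rep G r' -> (a' + b' < k.+1)%N ->
    (exists y, forall g, g \in G -> (r' g).2 y = y) \/
    (exists y1 y2, (forall g, g \in G -> (r' g).2 y1 = y1 <-> (r' g).2 y2 = y2) /\
       ~ col_sim G r' y1 y2) -> realizable a' b'.
  move=> rep_r' lt_k' [[y fix_y]|[y1 [y2 [stab nsim]]]].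
    have [rM inj1 inj2 _] := rep_r'.
    case: b' => [|b'] in r' rep_r' lt_k' y fix_y rM inj1 inj2 *.
      case: nontriv => g Gg; apply: inj2; rewrite ?group1 //.
      by apply/permP => z; rewrite [LHS]ord1 [RHS]ord1.
    have [r2 rep_r2] := paired_rep_drop_fixed rep_r' fix_y.
    apply: (realizable_le (leqnn a') (leqnSn b')); apply: IH rep_r2.
    by rewrite addnS in lt_k'.
  have [|b2 [r2 [lt_b2 rep_r2]]] := paired_rep_drop_dup rep_r' stab.
    by move=> g Gg eq_y; apply: nsim; exists g.
  apply: (realizable_le (leqnn a') (ltnW lt_b2)); apply: IH rep_r2.
  by apply: (@leq_trans (a' + b')%N); rewrite ?ltn_add2l // -ltnS.
pose bad a' b' (r' : gT -> 'S_a'.+1 * 'S_b'.+1) :=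
  (exists y, forall g, g \in G -> (r' g).2 y = y) \/
  (exists y1 y2, (forall g, g \in G -> (r' g).2 y1 = y1 <-> (r' g).2 y2 = y2) /\
     ~ col_sim G r' y1 y2).
have rep_s := paired_rep_swap rep_r.
have [bad_r|good_r] := pselect (bad a b r); first exact: dropP bad_r.
have [bad_s|good_s] := pselect (bad b a (swap_rep r)).
  by apply: realizable_swap; apply: dropP bad_s => //; rewrite addnC.
have moves a' b' (r' : gT -> 'S_a'.+1 * 'S_b'.+1) : ~ bad a' b' r' ->
    (forall y, exists2 g, g \in G & (r' g).2 y != y) /\
    (forall y1 y2, (forall g, g \in G -> (r' g).2 y1 = y1 <-> (r' g).2 y2 = y2) ->
     col_sim G r' y1 y2).
  move=> good; split=> [y|y1 y2 stab].
    apply: contrapT => no_g; apply: good; left; exists y => g Gg.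
    by apply/eqP/negPn/negP => ne_y; apply: no_g; exists g.
  by apply: contrapT => nsim; apply: good; right; exists y1, y2.
have [fix_c dup_c] := moves _ _ _ good_r; have [fix_r dup_r] := moves _ _ _ good_s.
have [le_reps|/ltnW le_reps] := leqP #|row_reps G r| #|col_reps G r|.
  by have [A realA] := construction rep_r fix_r fix_c dup_c le_reps; exists a, b, A, r.
apply: realizable_swap.
by have [A realA] := construction rep_s fix_c fix_r dup_r le_reps; exists b, a, A, (swap_rep r).
Qed.

(** Repeating rows and columns of a matrix does not change its core. *)
Lemma realizable_schutzenberger n m : realizable n m ->
  exists A : 'M[R]_(n.+1, m.+1), schutzenberger_iso_prod (greenH (mx_arrow A)) G.
Proof.
case=> p [q [A [rho [le_p le_q realA]]]].
pose B := \matrix_(i < n.+1, j < m.+1) A (inord i) (inord j).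
pose iota := widen_ord (le_p : (p.+1 <= n.+1)%N); pose kappa := widen_ord (le_q : (q.+1 <= m.+1)%N).
have iotaK x : inord (iota x) = x by rewrite inord_val.
have kappaK y : inord (kappa y) = y by rewrite inord_val.
exists B; apply: (@schutzenberger_core _ _ _ _ _ B iota kappa gT G rho).
- by move=> i j; exists (inord i) => j'; rewrite !mxE iotaK addrC.
- by move=> j i; exists (inord j) => i'; rewrite !mxE kappaK addrC.
rewrite (_ : mxsub iota kappa B = A) //; apply/matrixP => x y.
by rewrite !mxE iotaK kappaK.
Qed.

End GroupToHClass.

Theorem corollary6p4 (R : realType) (n m : nat) :
  (forall H : set (arrow (MFT R)),
     is_Hclass H -> (H `<=` MFT_size R n m)%classic ->
     exists G : {group 'S_n.+1},
       has_paired_2closed_rep G n.+1 m.+1 /\ schutzenberger_iso_prod H G) /\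
  (forall G : {group 'S_n.+1},
     has_paired_2closed_rep G n.+1 m.+1 ->
     exists H : set (arrow (MFT R)),
       [/\ is_Hclass H, (H `<=` MFT_size R n m)%classic
         & schutzenberger_iso_prod H G]).
Proof.
split=> [H [c eqH] sub_H|G rep_G].
  have : MFT_size R n m c by apply: sub_H; rewrite eqH.
  case=> A _ eq_c; have [G [rep_G iso_G]] := Hclass_schutzenberger A.
  by exists G; split; rewrite // eqH -eq_c.
have [r rep_r] := has_rep_paired_rep rep_G.
have [A isoA] := realizable_schutzenberger (paired_rep_realizable R rep_r).
exists (greenH (mx_arrow A)); split=> //; first by exists (mx_arrow A).
by move=> b /greenHP[B -> _]; exists B.
Qed.
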